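(* Let $F:\Sigma^n\to\mathbb{R}^{n+1}$ be a complete, mean-convex self-expander such that $$\lim_{r\to\infty}\ \sup_{\Sigma\setminus B_r(0)}|A|=0 .$$ Let $\lambda>0$ be a real number and let $f\in C^2(\Sigma)$ satisfy $\left(L+\tfrac12\right)f=\lambda f$ on $\Sigma$, where $$L\varphi=\Delta\varphi+\tfrac12\langle F,\nabla\varphi\rangle+\left(|A|^2-\tfrac12\right)\varphi ,$$ and $$\lim_{r\to\infty}\ \sup_{\Sigma\setminus B_r(0)}|f|=0 .$$ Then $f\equiv0$ on $\Sigma$.
   Context: $F:\Sigma^n\to\mathbb{R}^{n+1}$ is a smooth immersed orientable hypersurface (without boundary) with unit normal $\nu$; $h_{ij}=\left\langle\frac{\partial^2F}{\partial u_i\partial u_j},\nu\right\rangle$, $H=g^{ij}h_{ij}$, where $g$ is the induced metric; $A$ denotes the second fundamental form and $|A|$ its norm with respect to $g$. $\Sigma$ is a self-expander if $H=\frac12\langle F,\nu\rangle$, and mean-convex if $H>0$ everywhere. $\Delta$ and $\nabla$ are the Laplacian and gradient of the induced metric on $\Sigma$; in $\langle F,\nabla\varphi\rangle$ the gradient is regarded as a vector in $\mathbb{R}^{n+1}$ via $dF$. $B_r(0)$ is the ball of radius $r$ centered at the origin in $\mathbb{R}^{n+1}$; $\Sigma\setminus B_r(0)$ denotes the set of points $p\in\Sigma$ with $F(p)\notin B_r(0)$, and $\Sigma\cap B_r(0)$ is understood similarly. Complete is understood in the sense that the intersection of $\Sigma$ with every closed ball of $\mathbb{R}^{n+1}$ centered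 at the origin is compact (i.e. $F$ is proper). *)

(* Defs.v *)
From HB Require Import structures.
From mathcomp Require Import all_boot all_order all_algebra.
From mathcomp Require Import all_classical all_reals all_analysis.

Set Implicit Arguments.
Unset Strict Implicit.
Unset Printing Implicit Defensive.

Import Order.TTheory GRing.Theory Num.Theory.
Import numFieldNormedType.Exports.

Local Open Scope classical_set_scope.
Local Open Scope ring_scope.

Section Euclidean.
Variables (R : realType) (m : nat).
Implicit Types x y : 'rV[R]_m.

Definition dot x y : R := \sum_(i < m) x 0 i * y 0 i.

(* Not the norm `|x| of the matrix library, which is the sup norm. *)
Definition enorm x : R := Num.sqrt (dot x x).

End Euclidean.

Section Partial.
Variables (R : realType) (n : nat) (W : normedModType R).
Implicit Types (f : 'rV[R]_n -> W) (U : set 'rV[R]_n).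

Definition partial (i : 'I_n) f (u : 'rV[R]_n) : W := 'D_(delta_mx 0 i) f u.

(* C^k on an open set U. *)
Fixpoint Ck (k : nat) U f : Prop :=
  match k with
  | 0 => forall u, U u -> {for u, continuous f}
  | k'.+1 => (forall u, U u -> differentiable f u) /\
             (forall i, Ck k' U (partial i f))
  end.

End Partial.

(* cmap and cinv are total; only their values on cdom and on cmap @` cdom are
   meaningful. *)
Record chart (R : realType) (n : nat) (T : topologicalType) := Chart {
  cdom : set T;
  cmap : T -> 'rV[R]_n;
  cinv : 'rV[R]_n -> T;
  cdom_open : open cdom;
  cimg_open : open (cmap @` cdom);
  cmapK : forall p, cdom p -> cinv (cmap p) = p;
  cmap_continuous : forall p, cdom p -> {for p, continuous cmap};
  cinv_continuous :
    forall u, (cmap @` cdom) u -> {for u, continuous cinv}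
}.

Record smooth_manifold (R : realType) (n : nat) := SmoothManifold {
  carrier :> topologicalType;
  atlas : set (chart R n carrier);
  carrier_hausdorff : hausdorff_space carrier;
  carrier_second_countable : @second_countable carrier;
  atlas_cover : forall p : carrier, exists2 c, atlas c & cdom c p;
  atlas_compatible : forall c d, atlas c -> atlas d -> forall k,
    Ck k (cmap c @` (cdom c `&` cdom d)) (cmap d \o cinv c)
}.

Section Manifold.
Variables (R : realType) (n : nat) (S : smooth_manifold R n).

(* The geometric quantities below do not depend on the chart in which they are
   computed, so each is evaluated at p in one selected chart around p. *)
Definition chart_at (p : S) : chart R n S := projT1 (cid2 (atlas_cover p)).

Definition CkM (W : normedModType R) (k : nat) (f : S -> W) : Prop :=
  forall c, atlas c -> Ck k (cmap c @` cdom c) (f \o cinv c).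

Definition smoothM (W : normedModType R) (f : S -> W) : Prop :=
  forall k, CkM k f.

End Manifold.

(* Geometry in local coordinates: X is a local parametrization, N the unit
   normal and phi a function, all expressed in the coordinates u. *)
Section Local.
Variables (R : realType) (n : nat).
Variables (X N : 'rV[R]_n -> 'rV[R]_n.+1) (phi : 'rV[R]_n -> R).
Implicit Type u : 'rV[R]_n.

Definition metric u : 'M[R]_n :=
  \matrix_(i, j) dot (partial i X u) (partial j X u).

Definition second_form u : 'M[R]_n :=
  \matrix_(i, j) dot (partial i (partial j X) u) (N u).

Definition local_mean_curvature u : R :=
  let gV := invmx (metric u) in
  \sum_i \sum_j gV i j * second_form u i j.

Definition local_norm2A u : R :=
  let gV := invmx (metric u) in
  let h := second_form u in
  \sum_i \sum_j \sum_k \sum_l gV i k * gV j l * h i j * h k l.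

(* Gamma^k_ij of the Levi-Civita connection *)
Definition christoffel u (k i j : 'I_n) : R :=
  2^-1 * \sum_l invmx (metric u) k l *
    (partial i (fun v => metric v j l) u + partial j (fun v => metric v i l) u
     - partial l (fun v => metric v i j) u).

(* Trace of the covariant Hessian. *)
Definition local_laplacian u : R :=
  \sum_i \sum_j invmx (metric u) i j *
    (partial i (partial j phi) u - \sum_k christoffel u k i j * partial k phi u).

(* The image under dX of the gradient. *)
Definition local_gradient u : 'rV[R]_n.+1 :=
  \sum_i \sum_j (invmx (metric u) i j * partial j phi u) *: partial i X u.

End Local.

Section Hypersurface.
Variables (R : realType) (n : nat) (S : smooth_manifold R n).
Variables (F nu : S -> 'rV[R]_n.+1).

Definition smooth_immersion : Prop :=
  smoothM F /\
  (forall c, atlas c -> forall u, (cmap c @` cdom c) u ->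
     row_free (\matrix_(i < n) partial i (F \o cinv c) u)).

Definition unit_normal : Prop :=
  [/\ smoothM nu,
      (forall p, enorm (nu p) = 1) &
      (forall c, atlas c -> forall p, cdom c p -> forall i,
         dot (partial i (F \o cinv c) (cmap c p)) (nu p) = 0)].

Definition complete_immersion : Prop :=
  forall r : R, compact [set p | enorm (F p) <= r].

Definition mean_curvature (p : S) : R :=
  let c := chart_at p in
  local_mean_curvature (F \o cinv c) (nu \o cinv c) (cmap c p).

Definition normA (p : S) : R :=
  let c := chart_at p in
  Num.sqrt (local_norm2A (F \o cinv c) (nu \o cinv c) (cmap c p)).

Definition laplacian (phi : S -> R) (p : S) : R :=
  let c := chart_at p in
  local_laplacian (F \o cinv c) (phi \o cinv c) (cmap c p).

Definition gradient (phi : S -> R) (p : S) : 'rV[R]_n.+1 :=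
  let c := chart_at p in
  local_gradient (F \o cinv c) (phi \o cinv c) (cmap c p).

Definition self_expander : Prop :=
  forall p, mean_curvature p = 2^-1 * dot (F p) (nu p).

Definition mean_convex : Prop := forall p, 0 < mean_curvature p.

Definition stability_operator (phi : S -> R) (p : S) : R :=
  laplacian phi p + 2^-1 * dot (F p) (gradient phi p)
  + (normA p ^+ 2 - 2^-1) * phi p.

(* Supremum of a nonnegative function q over the points outside the open ball
   of radius r; adjoining 0 only matters for the empty set, whose supremum is
   then 0 instead of -oo. *)
Definition sup_outside (q : S -> R) (r : R) : \bar R :=
  ereal_sup (0%E |` [set (q p)%:E | p in ~` [set p | enorm (F p) < r]]).

Definition vanishes_at_infinity (q : S -> R) : Prop :=
  sup_outside q r @[r --> +oo%R] --> 0%E.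

End Hypersurface.

(* Main.v *)
Require Import Defs.
From mathcomp Require Import all_boot all_order all_algebra perm.
From mathcomp Require Import all_classical all_reals all_analysis.
From mathcomp Require Import ring lra.

(* A self-expander has H = <F, nu> / 2, and the Weingarten and Codazzi equations
   turn this into
     Delta H + <F, grad H> / 2 + |A|^2 H = - H / 2,
   so the positive function H is a strict supersolution of the eigenvalue
   equation. Choose a compact K = Sigma :&: B_r outside of which
   |A|^2 <= lambda / 2. If t >= 0 and f <= t H on K, then f <= t H everywhere:
   a positive maximum of f - t H, which exists since f vanishes at infinity,
   would lie outside K, where the equation rules it out. If f is positive
   somewhere, the maximum t of f / H on K is therefore positive and f <= t H
   everywhere, with equality at a point of K; evaluating the equations at this
   maximum of f - t H gives a contradiction. The same applies to - f.

   H is defined by choosing a chart at each point; to differentiate it one needs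
   its independence of the chart, which by h_ij = - <d_i nu, d_j F> involves
   only first derivatives of the change of coordinates. *)

Set Implicit Arguments.
Unset Strict Implicit.
Unset Printing Implicit Defensive.

Import Order.TTheory GRing.Theory Num.Theory.
Import numFieldNormedType.Exports.
Local Open Scope classical_set_scope.
Local Open Scope ring_scope.

(** * Directional derivatives *)

Section DirectionalDerivatives.
Variables (R : realType) (V : normedModType R).
Implicit Types (u v : V).

Lemma is_derive_mul (f g : V -> R) u v (df dg : R) :
  is_derive u v f df -> is_derive u v g dg ->
  is_derive u v (fun x => f x * g x) (df * g u + f u * dg).
Proof.
move=> hf hg; apply: (is_derive_eq (is_deriveM hf hg)).
by rewrite addrC (mulrC df).
Qed.

Lemma is_derive_add (f g : V -> R) u v (df dg : R) :
  is_derive u v f df -> is_derive u v g dg ->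
  is_derive u v (fun x => f x + g x) (df + dg).
Proof. by move=> hf hg; exact: is_deriveD. Qed.

Lemma derivable_mul (f g : V -> R) u v :
  derivable f u v -> derivable g u v -> derivable (fun x => f x * g x) u v.
Proof.
by move=> /derivableP hf /derivableP hg; have [] := is_derive_mul hf hg.
Qed.

Lemma is_derive_big_sum (I : Type) (r : seq I) (P : pred I) (h : I -> V -> R)
    (dh : I -> R) u v :
  (forall i, P i -> is_derive u v (h i) (dh i)) ->
  is_derive u v (fun x => \sum_(i <- r | P i) h i x) (\sum_(i <- r | P i) dh i).
Proof.
move=> hd; elim: r => [|i r IHr].
  rewrite big_nil (_ : (fun _ => _) = cst 0); first exact: is_derive_cst.
  by apply/funext => x; rewrite big_nil.
rewrite big_cons.
under eq_fun do rewrite big_cons.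
case: ifP => // Pi.
exact: is_derive_add (hd i Pi) IHr.
Qed.

Lemma derivable_big_prod (I : Type) (r : seq I) (P : pred I) (h : I -> V -> R)
    u v :
  (forall i, P i -> derivable (h i) u v) ->
  derivable (fun x => \prod_(i <- r | P i) h i x) u v.
Proof.
move=> hd; elim: r => [|i r IHr].
  rewrite (_ : (fun _ => _) = cst 1); first exact: derivable_cst.
  by apply/funext => x; rewrite big_nil.
under eq_fun do rewrite big_cons.
case: ifP => [Pi|_]; last exact: IHr.
by apply: derivable_mul; [exact: hd|exact: IHr].
Qed.

Lemma is_derive_dot m (X Y : V -> 'rV[R]_m) u v :
  derivable X u v -> derivable Y u v ->
  is_derive u v (fun x => dot (X x) (Y x))
    (dot ('D_v X u) (Y u) + dot (X u) ('D_v Y u)).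
Proof.
move=> dX dY.
have := dX; have := dY => /derivable_mxP dYc /derivable_mxP dXc.
rewrite /dot -big_split /=; apply: is_derive_big_sum => i _.
have hX := derivableP (dXc 0 i); have hY := derivableP (dYc 0 i).
by rewrite (derive_mx dX) (derive_mx dY) !mxE; exact: is_derive_mul.
Qed.

Lemma is_derive_mulmx m n p (A : V -> 'M[R]_(m, n)) (B : V -> 'M[R]_(n, p))
    u v :
  derivable A u v -> derivable B u v ->
  is_derive u v (fun x => A x *m B x) ('D_v A u *m B u + A u *m 'D_v B u).
Proof.
move=> dA dB.
have dAc := (derivable_mxP _ _ _).1 dA; have dBc := (derivable_mxP _ _ _).1 dB.
have hij i j : is_derive u v (fun x => (A x *m B x) i j)
    (('D_v A u *m B u + A u *m 'D_v B u) i j).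
  under eq_fun do rewrite !mxE.
  rewrite !mxE -big_split /=; apply: is_derive_big_sum => k _.
  have hA := derivableP (dAc i k); have hB := derivableP (dBc k j).
  by rewrite (derive_mx dA) (derive_mx dB) !mxE; exact: is_derive_mul.
have dAB : derivable (fun x => A x *m B x) u v.
  by apply/derivable_mxP => i j; have [] := hij i j.
apply: DeriveDef => //; rewrite derive_mx//; apply/matrixP => i j.
by rewrite mxE; have [] := hij i j.
Qed.

Lemma derivable_det n (A : V -> 'M[R]_n) u v :
  derivable A u v -> derivable (fun x => \det (A x)) u v.
Proof.
move=> /derivable_mxP dA; rewrite /determinant.
apply: (@ex_derive _ _ _ _ _ _ (\sum_(s : {perm 'I_n})
  'D_v (fun x => (-1) ^+ s * \prod_i A x i (s i)) u)).
apply: is_derive_big_sum => s _; apply: derivableP; apply: derivable_mul.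
  exact: derivable_cst.
by apply: derivable_big_prod => i _; exact: dA.
Qed.

(** Cramer's formula: near [u] the inverse is the reciprocal of the determinant times the adjugate,
    whose entries are polynomials in those of [A]. Invertibility is asked near [u], since [invmx]
    follows the formula only on invertible matrices. *)
Lemma derivable_invmx n (A : V -> 'M[R]_n) u v :
  derivable A u v -> (\forall x \near u, A x \in unitmx) ->
  derivable (fun x => invmx (A x)) u v.
Proof.
move=> dA unitA.
apply: (@near_eq_derivable _ _ _ (fun x => (\det (A x))^-1 *: \adj (A x))).
  by near=> x; rewrite /invmx (near unitA x).
have dAc := (derivable_mxP _ _ _).1 dA.
apply/derivable_mxP => i j; under eq_fun do rewrite !mxE /cofactor.
apply: derivable_mul.
  apply: derivableV; last exact: derivable_det.
  by rewrite -unitfE; exact: nbhs_singleton unitA.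
apply: derivableM; first exact: derivable_cst.
apply: derivable_det; apply/derivable_mxP => k l.
by under eq_fun do rewrite !mxE; exact: dAc.
Unshelve. all: by end_near. Qed.

(** Differentiate [invmx (A x) *m A x = 1], valid near [u], and multiply by [invmx (A u)] on the
    right. *)
Lemma derive_invmx n (A : V -> 'M[R]_n) u v :
  derivable A u v -> (\forall x \near u, A x \in unitmx) ->
  'D_v (fun x => invmx (A x)) u =
    - (invmx (A u) *m 'D_v A u *m invmx (A u)).
Proof.
move=> dA unitA; have dG := derivable_invmx dA unitA.
have Au := nbhs_singleton unitA.
have [_] := is_derive_mulmx dG dA.
rewrite (@near_eq_derive _ _ _ _ (cst 1%:M)).
  rewrite derive_cst => /esym/(congr1 (mulmx^~ (invmx (A u)))).
  rewrite mulmxDl mul0mx -!mulmxA mulmxV// mulmx1 !mulmxA.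
  by move=> /eqP; rewrite addr_eq0 => /eqP.
by near=> x; rewrite mulVmx// (near unitA x).
Unshelve. all: by end_near. Qed.

Lemma differentiable_dot m (X Y : V -> 'rV[R]_m) u :
  differentiable X u -> differentiable Y u ->
  differentiable (fun x => dot (X x) (Y x)) u.
Proof.
move=> dX dY; rewrite /dot.
rewrite (_ : (fun _ => _) = \sum_(i < m) (fun x => X x 0 i * Y x 0 i)).
  apply: differentiable_sum => i; apply: differentiableM.
    exact: (differentiable_comp dX (differentiable_coord _ _ _)).
  exact: (differentiable_comp dY (differentiable_coord _ _ _)).
by apply/funext => x; rewrite fct_sumE.
Qed.

(** The two difference quotients coincide; this reduces directional derivatives to one real
    variable, where the mean value theorem applies. *)
Lemma is_derive_line (W : normedModType R) (f : V -> W) u v (t : R) :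
  derivable f (t *: v + u) v ->
  is_derive t 1 (fun s : R => f (s *: v + u)) ('D_v f (t *: v + u)).
Proof.
have E : (fun h : R => h^-1 *: (((fun s : R => f (s *: v + u)) \o shift t)
      (h *: (1 : R)) - f (t *: v + u))) =
    (fun h => h^-1 *: ((f \o shift (t *: v + u)) (h *: v) - f (t *: v + u))).
  apply/funext => h /=; rewrite (_ : h *: (1 : R) = h); last exact: mulr1.
  by rewrite scalerDl addrA.
by move=> df; apply: DeriveDef; rewrite /derivable /derive E.
Qed.

End DirectionalDerivatives.

(** * Second derivatives at a maximum, and symmetry of mixed derivatives *)

Section SecondDerivatives.
Variable R : realType.

Lemma MVT0 (p dp : R -> R) (h : R) : 0 < h ->
  (forall t, 0 <= t <= h -> is_derive t 1 p (dp t)) ->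
  exists2 c, 0 < c < h & p h - p 0 = dp c * h.
Proof.
move=> h0 hp.
have hpi t : t \in `[0, h]%R -> is_derive t 1 p (dp t).
  by rewrite in_itv /=; exact: hp.
have H1 x : x \in `]0, h[%R -> is_derive x 1 p (dp x).
  by move=> /subset_itv_oo_cc; exact: hpi.
have H2 : {within `[0, h], continuous p}.
  by apply: derivable_within_continuous => t ti; have [] := hpi t ti.
have [c cI E] := MVT h0 H1 H2.
exists c; first by move: cI; rewrite in_itv.
by rewrite subr0 in E.
Qed.

(** If [ddp] were positive, [dp], which vanishes at 0, would be positive just to the right of 0, and
    the mean value theorem would give [p h > p 0] for a small [h > 0]. *)
Lemma second_derivative_at_max1 (p dp : R -> R) (d ddp : R) : 0 < d ->
  (forall t : R, `|t| < d -> is_derive t 1 p (dp t)) ->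
  is_derive (0 : R) (1 : R) dp ddp ->
  (forall t, `|t| < d -> p t <= p 0) ->
  dp 0 = 0 /\ ddp <= 0.
Proof.
move=> d0 hp hdp pmax.
have inI t : t \in `]- d, d[%R -> `|t| < d by rewrite in_itv /= ltr_norml.
have dp0 : dp 0 = 0.
  have h0 : `|0 : R| < d by rewrite normr0.
  have [_ <-] := hp 0 h0.
  have [] // := @derive1_at_max R p (- d) d 0.
  - by lra.
  - by move=> t /inI /hp [].
  - by rewrite in_itv /= oppr_lt0 d0.
  - by move=> t /inI; exact: pmax.
split=> //; rewrite leNgt; apply/negP => ddp0.
have [cv dv] := hdp.
have : h^-1 *: (dp (h *: (1:R) + 0) - dp 0) @[h --> 0^'] --> ddp.
  by rewrite -dv; exact: cv.
move/cvgrPdist_lt => /(_ _ ddp0) /nbhs_ballP [e /= e0 He].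
(* Halving keeps the closed interval from 0 to [h] inside both open neighbourhoods. *)
pose h := Num.min (d / 2) (e / 2).
have h0 : 0 < h by rewrite lt_min !divr_gt0.
have hd : h < d.
  by rewrite gt_min; apply/orP; left; lra.
have he : h < e by rewrite gt_min; apply/orP; right; lra.
have [|c /andP[c0 ch] E] := @MVT0 p dp h h0.
  by move=> t /andP[t0 th]; apply: hp; rewrite ger0_norm//; lra.
have dpc : 0 < dp c.
  have cb : ball_ Num.norm 0 e c.
    by rewrite /ball_ /= sub0r normrN gtr0_norm//; lra.
  have := He c cb; rewrite /= gt_eqF// => /(_ isT).
  rewrite dp0 subr0 addr0 (_ : c *: (1:R) = c); last exact: mulr1.
  rewrite (_ : c^-1 *: dp c = c^-1 * dp c)// => H.
  have : 0 < c^-1 * dp c.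
    by move: H; rewrite ltr_norml => /andP[_]; lra.
  by rewrite pmulr_rgt0// invr_gt0.
have := pmax h; rewrite gtr0_norm// => /(_ hd).
have : 0 < dp c * h by exact: mulr_gt0.
by rewrite -E; lra.
Qed.

Lemma near_line (V : normedModType R) (u v : V) (P : set V) :
  (\forall x \near u, P x) ->
  exists2 d : R, 0 < d & forall t, `|t| < d -> P (t *: v + u).
Proof.
move=> /nbhs_ballP [e /= e0 He].
(* The summand 1 keeps the denominator positive when [v = 0]. *)
exists (e / (`|v| + 1)); first by rewrite divr_gt0// ltr_wpDl.
move=> t td; apply: He; rewrite -ball_normE /ball_ /= opprD addrC subrK normrN.
rewrite normrZ; apply: (@le_lt_trans _ _ (`|t| * (`|v| + 1))).
  by rewrite ler_wpM2l// lerDl.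
by rewrite -ltr_pdivlMr// ltr_wpDl.
Qed.

Lemma second_derivative_at_max (V : normedModType R) (f : V -> R) u v :
  (\forall x \near u, derivable f x v) -> derivable ('D_v f) u v ->
  (\forall x \near u, f x <= f u) ->
  'D_v f u = 0 /\ 'D_v ('D_v f) u <= 0.
Proof.
move=> df ddf fmax.
have [d1 d10 D1] := near_line v df.
have [d2 d20 D2] := near_line v fmax.
have E0 : u = 0 *: v + u by rewrite scale0r add0r.
pose p t := f (t *: v + u); pose dp t := 'D_v f (t *: v + u).
have [] := @second_derivative_at_max1 p dp (Num.min d1 d2) ('D_v ('D_v f) u).
- by rewrite lt_min d10.
- move=> t; rewrite lt_min => /andP[t1 _].
  by apply: is_derive_line; exact: D1.
- rewrite [in X in is_derive _ _ _ X]E0.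
  by apply: (is_derive_line (f := 'D_v f)); rewrite -E0.
- move=> t; rewrite lt_min => /andP[_ t2]; rewrite /p -E0; exact: D2.
- by rewrite /dp -E0.
Qed.

(** Two uses of the mean value theorem: along [v] for the increment of [f] in the direction [w],
    then along [w] for ['D_v f]. The left-hand side is symmetric in [v] and [w]. *)
Lemma mixed_difference (V : normedModType R) (f : V -> R) u v w (h : R) :
  0 < h ->
  (forall s t, 0 <= s <= h -> 0 <= t <= h ->
     derivable f (s *: v + t *: w + u) v /\
     derivable ('D_v f) (s *: v + t *: w + u) w) ->
  exists s t, [/\ 0 < s < h, 0 < t < h &
    f (h *: v + h *: w + u) - f (h *: v + u) - f (h *: w + u) + f u =
    'D_w ('D_v f) (s *: v + t *: w + u) * (h * h)].
Proof.
move=> h0 df.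
have hh : 0 <= h <= h by rewrite lexx ltW.
have h00 : 0 <= (0 : R) <= h by rewrite lexx ltW.
pose p s := f (s *: v + (h *: w + u)) - f (s *: v + u).
pose dp s := 'D_v f (s *: v + (h *: w + u)) - 'D_v f (s *: v + u).
have [s sh|s sh E1] := @MVT0 p dp h h0.
  have [df1 _] := df s h sh hh; have [df2 _] := df s 0 sh h00.
  rewrite -addrA in df1; rewrite scale0r addr0 in df2.
  exact: is_deriveB (is_derive_line df1) (is_derive_line df2).
have sh' : 0 <= s <= h by case/andP: sh => ? ?; rewrite !ltW.
pose q t := 'D_v f (t *: w + (s *: v + u)).
pose dq t := 'D_w ('D_v f) (t *: w + (s *: v + u)).
have [t th|t th E2] := @MVT0 q dq h h0.
  have [_ df1] := df s t sh' th.
  by apply: (is_derive_line (f := 'D_v f)); rewrite addrCA addrA.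
exists s, t; split=> //.
move: E1 E2; rewrite /p /dp /q /dq !scale0r !add0r.
rewrite (addrCA (h *: w)) (addrCA (t *: w)) !addrA => E1 E2.
by rewrite mulrA -[X in _ = X * h]E2 -E1; ring.
Qed.

(** Schwarz's theorem. The same second difference is [h * h] times either mixed derivative, each
    taken at some point near [u]; continuity at [u] then brings the two values within any [e] of
    each other. *)
Lemma derive_swap (V : normedModType R) (f : V -> R) u v w :
  (\forall x \near u, [/\ derivable f x v, derivable f x w,
     derivable ('D_v f) x w & derivable ('D_w f) x v]) ->
  {for u, continuous ('D_w ('D_v f))} ->
  {for u, continuous ('D_v ('D_w f))} ->
  'D_w ('D_v f) u = 'D_v ('D_w f) u.
Proof.
move=> df cvw cwv.
apply/eqP; rewrite -subr_eq0 -normr_le0 leNgt; apply/negP => e0.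
set e := `|_| in e0.
have e30 : 0 < e / 3 by rewrite divr_gt0.
have e33 : e / 3 + e / 3 < e by clear -e0; lra.
move: cvw => /cvgrPdist_lt/(_ _ e30) cvw.
move: cwv => /cvgrPdist_lt/(_ _ e30) cwv.
have /nbhs_ballP [r /= r0 Hr] : \forall x \near u,
    [/\ [/\ derivable f x v, derivable f x w,
        derivable ('D_v f) x w & derivable ('D_w f) x v],
      `|'D_w ('D_v f) u - 'D_w ('D_v f) x| < e / 3 &
      `|'D_v ('D_w f) u - 'D_v ('D_w f) x| < e / 3].
  apply: filterS3 df cvw cwv => x A B C.
  by split; [exact: A|exact: B|exact: C].
have N0 : 0 < `|v| + `|w| + 1 by rewrite ltr_wpDl// addr_ge0.
(* With this [h], all points of the parallelogram spanned by [h *: v] and [h *: w] at [u] lie within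
   [r / 2] of [u]. *)
pose h := r / 2 / (`|v| + `|w| + 1).
have h0 : 0 < h by rewrite !divr_gt0.
have hh0 : h * h != 0 by rewrite mulf_neq0// gt_eqF.
have Hst s t : 0 <= s <= h -> 0 <= t <= h -> ball u r (s *: v + t *: w + u).
  move=> /andP[s0 sh] /andP[t0 th].
  rewrite -ball_normE /ball_ /= opprD addrC subrK normrN.
  apply: (le_lt_trans (ler_normD _ _)); rewrite !normrZ !ger0_norm//.
  apply: (@le_lt_trans _ _ (h * (`|v| + `|w| + 1))); last first.
    by rewrite /h mulrVK ?unitfE ?gt_eqF//; lra.
  have := ler_wpM2r (normr_ge0 v) sh; have := ler_wpM2r (normr_ge0 w) th.
  by rewrite !mulrDr mulr1; lra.
have [s t st st'|s [t [sh th E1]]] := @mixed_difference V f u v w h h0.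
  have [[A _ C _] _ _] := Hr _ (Hst _ _ st st').
  by split; [exact: A|exact: C].
have [s' t' st st'|t' [s' [th' sh' E2]]] := @mixed_difference V f u w v h h0.
  have [[_ A _ C] _ _] := Hr _ (Hst _ _ st' st).
  by rewrite (addrC (s' *: _)); split; [exact: A|exact: C].
have W a : 0 < a < h -> 0 <= a <= h by case/andP => ? ?; rewrite !ltW.
have [_ H1 _] := Hr _ (Hst _ _ (W _ sh) (W _ th)).
have [_ _ H2] := Hr _ (Hst _ _ (W _ sh') (W _ th')).
(* Once the sums are reordered, [E1] and [E2] have the same left-hand side, which equates the two
   mixed derivatives at their respective points. *)
move: E2; rewrite (addrC (t' *: w) (s' *: v)) (addrC (h *: w) (h *: v)) => E2.
rewrite [X in X + _ = _]addrAC E1 in E2.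
have E3 := mulIf hh0.
move: H1 H2; rewrite (E3 _ _ E2).
move=> H1 H2; suff : e < e by rewrite ltxx.
rewrite {1}/e -(subrKA ('D_v ('D_w f) (s' *: v + t' *: w + u))).
apply: le_lt_trans (ler_normD _ _) _; rewrite [X in _ + X]distrC.
exact: lt_trans (ltrD H1 H2) e33.
Qed.

End SecondDerivatives.

(** * Partial derivatives *)

Section Ck.
Variables (R : realType) (n : nat).
Implicit Types (U : set 'rV[R]_n) (u v : 'rV[R]_n).

Lemma CkW (W : normedModType R) k U (f : 'rV[R]_n -> W) :
  Ck k.+1 U f -> Ck k U f.
Proof.
elim: k f => [|k IHk] f [df pf]; last by split=> // i; apply: IHk; exact: pf.
by move=> u Uu; apply: differentiable_continuous; exact: df.
Qed.

Lemma Ck_differentiable (W : normedModType R) k U (f : 'rV[R]_n -> W) u :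
  Ck k.+1 U f -> U u -> differentiable f u.
Proof. by move=> [df _]; exact: df. Qed.

Lemma Ck_derivable (W : normedModType R) k U (f : 'rV[R]_n -> W) u v :
  Ck k.+1 U f -> U u -> derivable f u v.
Proof. by move=> /Ck_differentiable df /df; exact: diff_derivable. Qed.

Lemma Ck_partial (W : normedModType R) k U (f : 'rV[R]_n -> W) i :
  Ck k.+1 U f -> Ck k U (partial i f).
Proof. by move=> [_]; exact. Qed.

Lemma Ck_continuous (W : normedModType R) k U (f : 'rV[R]_n -> W) u :
  Ck k U f -> U u -> {for u, continuous f}.
Proof.
by elim: k f => [|k IHk] f; [exact|move=> /CkW; exact: IHk].
Qed.

Lemma derive_sum_partial (W : normedModType R) (f : 'rV[R]_n -> W) u v :
  differentiable f u -> 'D_v f u = \sum_i v 0 i *: partial i f u.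
Proof.
move=> df; rewrite deriveE// {1}(row_sum_delta v) linear_sum.
by apply: eq_bigr => i _; rewrite linearZ /partial deriveE.
Qed.

End Ck.

(** * Chain rule, symmetry of second partials and maxima in coordinates *)

Section PartialDerivatives.
Variables (R : realType) (n : nat).
Implicit Types (U : set 'rV[R]_n) (u v : 'rV[R]_n).

Lemma near_eq_partial (W : normedModType R) (f g : 'rV[R]_n -> W) i u :
  (\forall v \near u, f v = g v) -> partial i f u = partial i g u.
Proof. exact: near_eq_derive. Qed.

Lemma partial_comp (W : normedModType R) m (phi : 'rV[R]_n -> 'rV[R]_m)
    (f : 'rV[R]_m -> W) i u :
  differentiable phi u -> differentiable f (phi u) ->
  partial i (f \o phi) u = \sum_a partial i phi u 0 a *: partial a f (phi u).
Proof.
move=> dphi df; rewrite /partial deriveE; last exact: differentiable_comp.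
by rewrite diff_comp//= -deriveE// -deriveE//; exact: derive_sum_partial.
Qed.

(** Schwarz's theorem is available for real functions, so it is applied to each component [Xa a];
    the rest transfers derivatives between [X] and its components on [U]. *)
Lemma partial_swap m U (X : 'rV[R]_n -> 'rV[R]_m) i j u :
  open U -> Ck 2 U X -> U u ->
  partial i (partial j X) u = partial j (partial i X) u.
Proof.
move=> oU CX Uu.
have nU x : U x -> \forall y \near x, U y.
  by move=> Ux; apply: open_nbhs_nbhs.
pose Xa (a : 'I_m) x := X x 0 a.
have dXa a k x : U x -> partial k X x 0 a = partial k (Xa a) x.
  move=> Ux; rewrite /partial derive_mx ?mxE//.
  exact: Ck_derivable CX Ux.
have der1 a k x : U x -> derivable (Xa a) x (delta_mx 0 k).
  move=> Ux; apply: (derivable_mxP _ _ _).1; exact: Ck_derivable CX Ux.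
have der2 a k l x : U x -> derivable (partial k (Xa a)) x (delta_mx 0 l).
  move=> Ux; apply: (@near_eq_derivable _ _ _ (fun x => partial k X x 0 a)).
    by apply: filterS (nU _ Ux) => y; exact: dXa.
  apply: (derivable_mxP _ _ _).1.
  exact: Ck_derivable (Ck_partial k CX) Ux.
have ddXa a k l x : U x ->
    partial l (partial k X) x 0 a = partial l (partial k (Xa a)) x.
  move=> Ux; rewrite {1}/partial derive_mx ?mxE; last first.
    exact: Ck_derivable (Ck_partial k CX) Ux.
  by apply: near_eq_partial; apply: filterS (nU _ Ux) => y; exact: dXa.
have cont a k l : {for u, continuous (partial l (partial k (Xa a)))}.
  have H : {for u, continuous (fun x => partial l (partial k X) x 0 a)}.
    apply: (continuous_comp (g := fun M : 'rV[R]_m => M 0 a)); last first.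
      exact: coord_continuous.
    exact: Ck_continuous (Ck_partial l (Ck_partial k CX)) Uu.
  have E : \forall x \near u,
      partial l (partial k X) x 0 a = partial l (partial k (Xa a)) x.
    by apply: filterS (nU _ Uu) => x; exact: ddXa.
  rewrite /prop_for /continuous_at -ddXa//.
  exact: cvg_trans (near_eq_cvg E) H.
apply: (rowP _ _).1 => a.
rewrite [LHS](ddXa a j i u Uu).
rewrite [RHS](ddXa a i j u Uu).
apply: (@derive_swap R _ (Xa a) u (delta_mx 0 j) (delta_mx 0 i)).
- apply: filterS (nU _ Uu) => x Ux.
  by split; [exact: der1|exact: der1|exact: der2|exact: der2].
- exact: cont.
- exact: cont.
Qed.

(** The [g j] are explicit formulas for the first partials on [U]; the quadratic form is then the
    second derivative of [f] along [v]. *)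
Lemma derivative_test_at_max U (f : 'rV[R]_n -> R)
    (g : 'I_n -> 'rV[R]_n -> R) u :
  open U -> U u -> (forall v, U v -> differentiable f v) ->
  (forall v j, U v -> partial j f v = g j v) ->
  (forall j, differentiable (g j) u) -> (forall v, U v -> f v <= f u) ->
  (forall i, partial i f u = 0) /\
  (forall v, \sum_i \sum_j v 0 i * v 0 j * partial i (g j) u <= 0).
Proof.
move=> oU Uu df fg dg fmax.
have nU : \forall x \near u, U x by apply: open_nbhs_nbhs.
have dd v : is_derive u v (fun x => \sum_j v 0 j * g j x)
    (\sum_j \sum_i v 0 i * v 0 j * partial i (g j) u).
  apply: is_derive_big_sum => j _.
  have hj := derivableP (diff_derivable (v := v) (dg j)).
  apply: (is_derive_eq (is_derive_mul (is_derive_cst (v 0 j) u v) hj)).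
  rewrite mul0r add0r derive_sum_partial// mulr_sumr; apply: eq_bigr => i _.
  by rewrite mulrCA mulrA.
have eqD v : \forall x \near u, \sum_j v 0 j * g j x = 'D_v f x.
  apply: filterS nU => x Ux; rewrite derive_sum_partial; last exact: df.
  by apply: eq_bigr => j _; rewrite fg.
have H v : 'D_v f u = 0 /\ 'D_v ('D_v f) u <= 0.
  apply: second_derivative_at_max.
  - by apply: filterS nU => x /df; exact: diff_derivable.
  - by apply: near_eq_derivable (eqD v) _; have [] := dd v.
  - by apply: filterS nU => x; exact: fmax.
split=> [i|v]; first by have [] := H (delta_mx 0 i).
have [_] := H v; rewrite -(near_eq_derive v (eqD v)).
by have [_ ->] := dd v; rewrite [in X in X -> _]exchange_big.
Qed.

End PartialDerivatives.

(** * Linear algebra of frames *)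

Section FrameAlgebra.
Variable R : realType.

Lemma dotE m (x y : 'rV[R]_m) : dot x y = (x *m y^T) 0 0.
Proof. by rewrite mxE; apply: eq_bigr => i _; rewrite mxE. Qed.

Lemma dotC m (x y : 'rV[R]_m) : dot x y = dot y x.
Proof. by apply: eq_bigr => i _; rewrite mulrC. Qed.

Lemma dot_ge0 m (x : 'rV[R]_m) : 0 <= dot x x.
Proof. by apply: sumr_ge0 => i _; rewrite -expr2 sqr_ge0. Qed.

Lemma dot_eq0 m (x : 'rV[R]_m) : dot x x = 0 -> x = 0.
Proof.
move=> /eqP; rewrite psumr_eq0 => [/allP H|i _]; last by rewrite -expr2 sqr_ge0.
apply/rowP => i; rewrite mxE; apply/eqP; rewrite -sqrf_eq0 expr2.
exact: H (mem_index_enum i).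
Qed.

(** If [v] is in the kernel, then [v *m E] has zero length, hence vanishes, and so does [v]. *)
Lemma gram_unit m n (E : 'M[R]_(n, m)) : row_free E -> E *m E^T \in unitmx.
Proof.
move=> Efree; rewrite -row_free_unit -kermx_eq0; apply/rowV0P => v.
move=> /sub_kermxP; rewrite mulmxA => vEE.
have : v *m E = 0.
  apply: dot_eq0; rewrite dotE trmx_mul mulmxA vEE mul0mx mxE //.
by move=> vE; apply: (row_free_inj Efree); rewrite mul0mx.
Qed.

(** Stacking [N] on [E] gives a square matrix [M] with right inverse [Q]; a right inverse of a
    square matrix is a left inverse, and [Q *m M = 1] is the claim. *)
Lemma frame_completeness n (E : 'M[R]_(n, n.+1)) (N : 'rV[R]_n.+1) :
  row_free E -> N *m E^T = 0 -> N *m N^T = 1%:M ->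
  N^T *m N + E^T *m invmx (E *m E^T) *m E = 1%:M.
Proof.
move=> Efree NE NN; have gU := gram_unit Efree.
have EN : E *m N^T = 0 by rewrite -[LHS]trmxK trmx_mul trmxK NE trmx0.
pose M : 'M[R]_(1 + n) := col_mx N E.
pose Q : 'M[R]_(1 + n) := row_mx N^T (E^T *m invmx (E *m E^T)).
have MQ : M *m Q = 1%:M.
  rewrite mul_col_row NN mulmxA NE mul0mx EN mulmxA mulmxV//.
  by rewrite -scalar_mx_block.
by have := mulmx1C MQ; rewrite mul_row_col.
Qed.

Lemma dot_frame n (E : 'M[R]_(n, n.+1)) (N v w : 'rV[R]_n.+1) :
  row_free E -> N *m E^T = 0 -> N *m N^T = 1%:M ->
  dot v w = dot v N * dot w N +
    ((v *m E^T) *m invmx (E *m E^T) *m (w *m E^T)^T) 0 0.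
Proof.
move=> Ef NE NN.
rewrite dotE -[v in LHS]mulmx1 -(frame_completeness Ef NE NN).
rewrite mulmxDr mulmxDl mxE; congr (_ + _).
  rewrite (dotC w) !dotE !mulmxA -mulmxA mxE big_ord1.
  by [].
by rewrite trmx_mul trmxK !mulmxA.
Qed.

Lemma sum_mul_mxtrace n (P Q : 'M[R]_n) :
  Q^T = Q -> \sum_i \sum_j P i j * Q i j = \tr (P *m Q).
Proof.
move=> Qs; apply: eq_bigr => i _; rewrite mxE; apply: eq_bigr => j _.
by rewrite -[in LHS]Qs mxE.
Qed.

Lemma sum4_mxtrace n (G h : 'M[R]_n) : G^T = G -> h^T = h ->
  \sum_i \sum_j \sum_k \sum_l G i k * G j l * h i j * h k l =
  \tr (G *m h *m G *m h).
Proof.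
move=> Gs hs; rewrite -sum_mul_mxtrace//; apply: eq_bigr => i _.
apply: eq_bigr => j _; rewrite mxE exchange_big mulr_suml.
apply: eq_bigr => l _; rewrite mxE !mulr_suml; apply: eq_bigr => k _.
have -> : G j l = G l j by rewrite -[in LHS]Gs mxE.
by ring.
Qed.

(** Substituting [DE] turns each side into [T] minus three terms of the form [A G h]; exchanging [i]
    and [l] permutes these terms because [A] is symmetric in its first two indices. *)
Lemma covariant_symmetry n (G h : 'M[R]_n) (A D : 'I_n -> 'M[R]_n)
    (T : 'I_n -> 'I_n -> 'I_n -> R) :
  G^T = G -> h^T = h ->
  (forall i j l, A i j l = A j i l) ->
  (forall i j l, D i j l = T i j l - (A j *m G *m h) l i) ->
  (forall i j l, T i j l = T l j i) ->
  forall i j l, (D i - h *m G *m (A i)^T - A i *m G *m h) j l =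
                (D l - h *m G *m (A l)^T - A l *m G *m h) j i.
Proof.
move=> Gs hs As DE Ts i j l.
have tr a b c : (h *m G *m (A a)^T) b c = (A a *m G *m h) c b.
  by rewrite -[A a *m G *m h]trmxK [in RHS]mxE !trmx_mul Gs hs mulmxA.
have sw a b c : (A a *m G *m h) b c = (A b *m G *m h) a c.
  by rewrite -!mulmxA !mxE; apply: eq_bigr => k _; rewrite As.
have E a b c : (D a - h *m G *m (A a)^T - A a *m G *m h) b c =
    D a b c - (A a *m G *m h) c b - (A a *m G *m h) b c.
  have subE (P Q : 'M[R]_n) : (P - Q) b c = P b c - Q b c by rewrite !mxE.
  by rewrite !subE tr.
by rewrite !E !DE (Ts i) (sw l i j) (sw j l i) (sw j i l); ring.
Qed.

(* [A i j l] stands for [<d_i d_j X, d_l X>], [D i] for [d_i h], and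
   [D i - h G A_i^T - A_i G h] for the covariant derivative of [h]. *)
Lemma expander_algebra n (G h : 'M[R]_n) (A D : 'I_n -> 'M[R]_n)
    (x dphi : 'rV[R]_n) (ddphi : 'M[R]_n) (s : R) :
  G^T = G -> h^T = h ->
  (forall i j l, (D i - h *m G *m (A i)^T - A i *m G *m h) j l =
                 (D l - h *m G *m (A l)^T - A l *m G *m h) j i) ->
  dphi = - 2^-1 *: (x *m G *m h) ->
  (forall i j, ddphi i j = 2^-1 *
     (- h i j - ((D i - h *m G *m (A i)^T) *m G *m x^T) j 0
      - s * (h *m G *m h) i j)) ->
  \tr (G *m h) = 2^-1 * s ->
  (forall l, dphi 0 l =
     \tr (G *m D l) - \tr (G *m (A l + (A l)^T) *m G *m h)) ->
  \sum_i \sum_j G i j *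
     (ddphi i j - \sum_k (\sum_l G k l * A i j l) * dphi 0 k)
  + 2^-1 * (\sum_i \sum_j G i j * dphi 0 j * x 0 i)
  + \tr (G *m h *m G *m h) * (2^-1 * s) = - 2^-1 * (2^-1 * s).
Proof.
move=> Gs hs codazzi dphiE ddphiE trGh dphiH.
pose C i := D i - h *m G *m (A i)^T - A i *m G *m h.
(* The metric is parallel, so the trace of the covariant derivative of [h] is the derivative of the
   trace. *)
have trC l : \tr (G *m C l) = dphi 0 l.
  have E1 : \tr (G *m (h *m G *m (A l)^T)) = \tr (G *m (A l)^T *m G *m h).
    by rewrite -(mulmxA h) mulmxA mxtrace_mulC !mulmxA.
  have E2 : \tr (G *m (A l *m G *m h)) = \tr (G *m A l *m G *m h).
    by rewrite !mulmxA.
  rewrite dphiH /C !mulmxBr !raddfB /= E1 E2 mulmxDr !mulmxDl mxtraceD.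
  by rewrite opprD addrA addrAC.
have chr i j : \sum_k (\sum_l G k l * A i j l) * dphi 0 k =
    - 2^-1 * (A i *m G *m h *m G *m x^T) j 0.
  transitivity ((A i *m G *m dphi^T) j 0).
    rewrite mxE; apply: eq_bigr => k _; rewrite !mxE; congr (_ * _).
    by apply: eq_bigr => l _; rewrite mulrC -[in LHS]Gs mxE.
  rewrite dphiE linearZ /= -scalemxAr mxE; congr (_ * _).
  by rewrite !trmx_mul Gs hs !mulmxA.
(* The Christoffel term supplies the summand [A i *m G *m h] that completes the covariant derivative
   [C i]. *)
have hess i j : ddphi i j - \sum_k (\sum_l G k l * A i j l) * dphi 0 k =
    2^-1 * (- h i j - (C i *m (G *m x^T)) j 0 - s * (h *m G *m h) i j).
  have subE (y z : 'cV[R]_n) : (y - z) j 0 = y j 0 - z j 0 by rewrite !mxE.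
  have -> : C i *m (G *m x^T) = (D i - h *m G *m (A i)^T) *m G *m x^T
      - A i *m G *m h *m G *m x^T by rewrite /C mulmxBl !mulmxA.
  by rewrite subE chr ddphiE; ring.
have t1 : \sum_i \sum_j G i j * h i j = \tr (G *m h).
  exact: sum_mul_mxtrace.
have t2 : \sum_i \sum_j G i j * (h *m G *m h) i j = \tr (G *m h *m G *m h).
  by rewrite sum_mul_mxtrace ?mulmxA// !trmx_mul Gs hs mulmxA.
(* The use of Codazzi: it moves the traced index [i] into [h], where [trC] evaluates the trace. *)
have t3 : \sum_i \sum_j G i j * (C i *m (G *m x^T)) j 0 =
    \sum_i \sum_j G i j * dphi 0 j * x 0 i.
  transitivity ((dphi *m (G *m x^T)) 0 0).
    move: (G *m x^T) => y.
    rewrite mxE; under [RHS]eq_bigr do rewrite -trC /mxtrace mulr_suml.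
    rewrite [RHS]exchange_big; apply: eq_bigr => i _ /=.
    under eq_bigr do rewrite mxE mulr_sumr.
    rewrite exchange_big; apply: eq_bigr => l _ /=.
    rewrite mxE mulr_suml; apply: eq_bigr => j _.
    by rewrite mulrA; congr (_ * _ * _); exact: codazzi.
  rewrite mulmxA mxE; apply: eq_bigr => i _; rewrite !mxE mulr_suml.
  apply: eq_bigr => j _; rewrite (mulrC (dphi 0 j)); congr (_ * _ * _).
  by rewrite -[in LHS]Gs mxE.
have -> : \sum_i \sum_j G i j *
     (ddphi i j - \sum_k (\sum_l G k l * A i j l) * dphi 0 k) =
   2^-1 * (- (\sum_i \sum_j G i j * h i j)
     - (\sum_i \sum_j G i j * (C i *m (G *m x^T)) j 0)
     - s * (\sum_i \sum_j G i j * (h *m G *m h) i j)).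
  rewrite mulr_sumr -!sumrN -!big_split mulr_sumr; apply: eq_bigr => i _ /=.
  rewrite mulr_sumr -!sumrN -!big_split mulr_sumr; apply: eq_bigr => j _ /=.
  by rewrite hess; ring.
(* The gradient term and the [|A|^2] term cancel, leaving minus half of [\tr (G *m h)]. *)
by rewrite t1 t2 t3 trGh; ring.
Qed.

(** [B *m B^T] is the sum of the rank-one squares of the columns of [B], and each contributes one
    value of the quadratic form. *)
Lemma trace_product_le0 n m (B : 'M[R]_(n, m)) (W : 'I_n -> 'I_n -> R) :
  (forall v : 'rV[R]_n, \sum_i \sum_j v 0 i * v 0 j * W i j <= 0) ->
  \sum_i \sum_j (B *m B^T) i j * W i j <= 0.
Proof.
move=> Wle0.
have -> : \sum_i \sum_j (B *m B^T) i j * W i j =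
    \sum_(a < m) \sum_i \sum_j (col a B)^T 0 i * (col a B)^T 0 j * W i j.
  rewrite [RHS]exchange_big; apply: eq_bigr => i _ /=.
  rewrite [RHS]exchange_big; apply: eq_bigr => j _ /=.
  by rewrite mxE mulr_suml; apply: eq_bigr => a _; rewrite !mxE.
by apply: sumr_le0 => a _; exact: Wle0.
Qed.

(** By cyclicity this is the trace of [K *m K] with [K = B^T *m h *m B] symmetric, a sum of
    squares. *)
Lemma mxtrace_sqr_ge0 n m (B : 'M[R]_(n, m)) (h : 'M[R]_n) : h^T = h ->
  0 <= \tr (B *m B^T *m h *m (B *m B^T) *m h).
Proof.
move=> hs; pose K := B^T *m h *m B.
have Ks : K^T = K by rewrite !trmx_mul trmxK hs mulmxA.
have -> : \tr (B *m B^T *m h *m (B *m B^T) *m h) = \tr (K *m K).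
  by rewrite -!(mulmxA B) mxtrace_mulC /K !mulmxA.
rewrite -sum_mul_mxtrace//; apply: sumr_ge0 => i _; apply: sumr_ge0 => j _.
by rewrite -expr2 sqr_ge0.
Qed.

(** Invertibility of [g1] forces that of [J] and [g2], so [invmx g2 = J^T *m invmx g1 *m J]; the
    trace is cyclic. *)
Lemma change_of_frame_mxtrace n (J g1 g2 h1 h2 : 'M[R]_n) :
  g1 \in unitmx -> g1 = J *m g2 *m J^T -> h1 = J *m h2 *m J^T ->
  \tr (invmx g1 *m h1) = \tr (invmx g2 *m h2).
Proof.
move=> g1U g1E ->; have := g1U.
rewrite g1E !unitmx_mul unitmx_tr => /andP[/andP[JU g2U] _]; rewrite -g1E.
have JTU : J^T \in unitmx by rewrite unitmx_tr.
rewrite !mulmxA mxtrace_mulC !mulmxA; congr (\tr (_ *m _)).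
apply: (can_inj (mulmxK g2U)); apply: (can_inj (mulmxK JTU)).
by rewrite mulVmx// mul1mx -!mulmxA [J *m _]mulmxA -g1E mulVmx// mulmx1.
Qed.

End FrameAlgebra.

(** * Local geometry *)

Section LocalHypersurface.
Variables (R : realType) (n : nat).
Implicit Types (X N : 'rV[R]_n -> 'rV[R]_n.+1) (U : set 'rV[R]_n).
Implicit Types u v : 'rV[R]_n.

Lemma dotZr m (x y : 'rV[R]_m) a : dot x (a *: y) = a * dot x y.
Proof. by rewrite mulr_sumr; apply: eq_bigr => i _; rewrite mxE mulrCA. Qed.

Lemma dot_sumr m (I : Type) (r : seq I) (P : pred I) (x : 'rV[R]_m) y :
  dot x (\sum_(i <- r | P i) y i) = \sum_(i <- r | P i) dot x (y i).
Proof.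
rewrite /dot exchange_big; apply: eq_bigr => i _ /=.
by rewrite summxE mulr_sumr.
Qed.

(** Third derivatives of [X] enter through the Codazzi equation, second derivatives of [N] through
    the Hessian of the support function. *)
Record local_hypersurface U X N : Prop := LocalHypersurface {
  lh_open : open U;
  lh_X : Ck 3 U X;
  lh_N : Ck 2 U N;
  lh_free : forall u, U u -> row_free (\matrix_(i < n) partial i X u);
  lh_perp : forall u, U u -> forall i, dot (partial i X u) (N u) = 0;
  lh_unit : forall u, U u -> dot (N u) (N u) = 1 }.

Definition frame X u : 'M[R]_(n, n.+1) := \matrix_i partial i X u.

Lemma metricE X u : metric X u = frame X u *m (frame X u)^T.
Proof.
by apply/matrixP => i j; rewrite !mxE; apply: eq_bigr => k _; rewrite !mxE.
Qed.

Lemma coordsE X u (w : 'rV[R]_n.+1) k :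
  (w *m (frame X u)^T) 0 k = dot w (partial k X u).
Proof. by rewrite mxE; apply: eq_bigr => i _; rewrite !mxE. Qed.

Lemma metric_sym X u : (metric X u)^T = metric X u.
Proof. by rewrite metricE trmx_mul trmxK. Qed.

Lemma partial_dot m U (Y Z : 'rV[R]_n -> 'rV[R]_m) i u :
  Ck 1 U Y -> Ck 1 U Z -> U u ->
  partial i (fun v => dot (Y v) (Z v)) u =
  dot (partial i Y u) (Z u) + dot (Y u) (partial i Z u).
Proof.
move=> CY CZ Uu.
exact: (@derive_val _ _ _ _ _ _ _ (is_derive_dot
  (Ck_derivable (v := delta_mx 0 i) CY Uu)
  (Ck_derivable (v := delta_mx 0 i) CZ Uu))).
Qed.

Lemma near_cst_partial (f : 'rV[R]_n -> R) (a : R) i u :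
  (\forall v \near u, f v = a) -> partial i f u = 0.
Proof.
by move=> /(@near_eq_partial _ _ _ _ (cst a)) ->; rewrite /partial derive_cst.
Qed.

Section AtPoint.
Local Opaque partial.
Variables (U : set 'rV[R]_n) (X N : 'rV[R]_n -> 'rV[R]_n.+1).
Hypothesis HXN : local_hypersurface U X N.

Let nearU u : U u -> \forall v \near u, U v.
Proof. by move=> Uu; apply: open_nbhs_nbhs; split=> //; exact: lh_open HXN. Qed.

Let C1X : Ck 1 U X. Proof. exact: CkW (CkW (lh_X HXN)). Qed.
Let C1N : Ck 1 U N. Proof. exact: CkW (lh_N HXN). Qed.
Let C2X : Ck 2 U X. Proof. exact: CkW (lh_X HXN). Qed.
Let C1dX i : Ck 1 U (partial i X). Proof. exact: Ck_partial C2X. Qed.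
Let C1dN i : Ck 1 U (partial i N). Proof. exact: Ck_partial (lh_N HXN). Qed.
Let C2dX i : Ck 2 U (partial i X). Proof. exact: Ck_partial (lh_X HXN). Qed.
Let C1ddX i j : Ck 1 U (partial i (partial j X)).
Proof. exact: Ck_partial (C2dX j). Qed.

Lemma metric_unit u : U u -> metric X u \in unitmx.
Proof. by move=> Uu; rewrite metricE gram_unit//; exact: lh_free HXN _ Uu. Qed.

Lemma invmx_metric_sym u : (invmx (metric X u))^T = invmx (metric X u).
Proof. by rewrite trmx_inv metric_sym. Qed.

Lemma second_form_sym u : U u -> (second_form X N u)^T = second_form X N u.
Proof.
move=> Uu; apply: (matrixP _ _).1 => i j; rewrite !mxE.
by rewrite (partial_swap j i (lh_open HXN) C2X Uu).
Qed.

(** Differentiate the orthogonality of [partial j X] and [N], which holds on all of [U]. *)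
Lemma dot_partialN_partialX u i j : U u ->
  dot (partial i N u) (partial j X u) = - second_form X N u i j.
Proof.
move=> Uu.
have E : partial i (fun v => dot (partial j X v) (N v)) u = 0.
  apply: (@near_cst_partial _ 0); apply: filterS (nearU Uu) => v Uv.
  exact: lh_perp HXN _ Uv _.
move: E; rewrite (partial_dot i (C1dX j) C1N Uu) => E.
by rewrite mxE dotC; exact: esym (addr0_eq E).
Qed.

Lemma dot_partialN_N u i : U u -> dot (partial i N u) (N u) = 0.
Proof.
move=> Uu.
have : partial i (fun v => dot (N v) (N v)) u = 0.
  apply: (@near_cst_partial _ 1); apply: filterS (nearU Uu) => v Uv.
  exact: lh_unit HXN _ Uv.
rewrite (partial_dot i C1N C1N Uu) (dotC (N u)) => /eqP.
by rewrite -mulr2n mulrn_eq0 /= => /eqP.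
Qed.

Lemma dot_ddN_N u i j : U u ->
  dot (partial i (partial j N) u) (N u) =
  - dot (partial i N u) (partial j N u).
Proof.
move=> Uu.
have E : partial i (fun v => dot (partial j N v) (N v)) u = 0.
  apply: (@near_cst_partial _ 0); apply: filterS (nearU Uu) => v Uv.
  exact: dot_partialN_N.
move: E; rewrite (partial_dot i (C1dN j) C1N Uu) => E.
rewrite addrC in E.
by rewrite (dotC (partial i N u)); exact: esym (addr0_eq E).
Qed.

Lemma dot_frameE u (v w : 'rV[R]_n.+1) : U u ->
  dot v w = dot v (N u) * dot w (N u) +
    ((v *m (frame X u)^T) *m invmx (metric X u) *m (w *m (frame X u)^T)^T) 0 0.
Proof.
move=> Uu; rewrite metricE; apply: dot_frame.
- exact: lh_free HXN _ Uu.
- apply/rowP => k; rewrite coordsE dotC mxE; exact: lh_perp HXN _ Uu _.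
- apply/matrixP => i j; rewrite !ord1 -dotE [RHS]mxE; exact: lh_unit HXN _ Uu.
Qed.

Lemma weingarten u i : U u ->
  partial i N u *m (frame X u)^T = - row i (second_form X N u).
Proof.
move=> Uu; apply: (rowP _ _).1 => k.
by rewrite coordsE (dot_partialN_partialX i k Uu) !mxE.
Qed.

(** As [partial i N] is tangential, only the tangential part of [w] contributes, and the Weingarten
    equation gives its coefficients. *)
Lemma dot_partialN u i (w : 'rV[R]_n.+1) : U u ->
  dot w (partial i N u) =
  - (w *m (frame X u)^T *m invmx (metric X u) *m second_form X N u) 0 i.
Proof.
move=> Uu; rewrite (dot_frameE _ _ Uu) (dot_partialN_N i Uu) mulr0 add0r.
rewrite (weingarten i Uu) linearN /= mulmxN mxE; congr (- _).
rewrite -[in RHS](second_form_sym Uu).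
by rewrite !mxE; apply: eq_bigr => k _; rewrite !mxE.
Qed.

(** The Christoffel symbols of the first kind. *)
Definition dd_coords u (i : 'I_n) : 'M[R]_n :=
  \matrix_(j, l) dot (partial i (partial j X) u) (partial l X u).

Definition d_second_form u (i : 'I_n) : 'M[R]_n :=
  \matrix_(j, l) partial i (fun v => second_form X N v j l) u.

Lemma dd_coords_entry u i j l :
  dd_coords u i j l = dot (partial i (partial j X) u) (partial l X u).
Proof. exact: mxE. Qed.

Lemma dd_coords_swap u i j l : U u -> dd_coords u i j l = dd_coords u j i l.
Proof.
move=> Uu.
rewrite [LHS]dd_coords_entry [RHS]dd_coords_entry.
by rewrite (partial_swap i j (lh_open HXN) C2X Uu).
Qed.

Lemma dd_coordsE u i j :
  partial i (partial j X) u *m (frame X u)^T = row j (dd_coords u i).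
Proof.
apply: (rowP _ _).1 => l.
by rewrite coordsE [RHS]mxE [RHS]dd_coords_entry.
Qed.

Lemma partial_metric u l i j : U u ->
  partial l (fun v => metric X v i j) u = dd_coords u l i j + dd_coords u l j i.
Proof.
move=> Uu; under eq_fun do rewrite mxE.
rewrite (partial_dot l (C1dX i) (C1dX j) Uu) (dotC (partial i X u)).
by congr (_ + _); exact: esym (dd_coords_entry _ _ _ _).
Qed.

(** Each derivative of the metric is a sum of two symbols; by symmetry in the first two indices all
    cancel except two equal ones. *)
Lemma christoffelE u k i j : U u ->
  christoffel X u k i j = \sum_l invmx (metric X u) k l * dd_coords u i j l.
Proof.
move=> Uu; rewrite /christoffel mulr_sumr; apply: eq_bigr => l _.
rewrite !(partial_metric _ _ _ Uu).
move: (dd_coords u) (fun a b c => dd_coords_swap a b c Uu) => A sw.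
by rewrite (sw j i l) (sw l i j) (sw l j i); field.
Qed.

Lemma partial_third_swap u i j l : U u ->
  partial i (partial j (partial l X)) u = partial l (partial j (partial i X)) u.
Proof.
move=> Uu; have oU := lh_open HXN.
have sw a b c : partial a (partial b (partial c X)) u =
    partial a (partial c (partial b X)) u.
  apply: near_eq_partial; apply: filterS (nearU Uu) => v Uv.
  exact: partial_swap oU C2X Uv.
transitivity (partial i (partial l (partial j X)) u); first exact: sw.
transitivity (partial l (partial i (partial j X)) u); last exact: sw.
exact: partial_swap oU (C2dX j) Uu.
Qed.

Lemma d_second_formE u i j l : U u ->
  d_second_form u i j l =
  dot (partial i (partial j (partial l X)) u) (N u) -
  (dd_coords u j *m invmx (metric X u) *m second_form X N u) l i.
Proof.
move=> Uu; rewrite mxE; under eq_fun do rewrite mxE.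
rewrite (partial_dot i (C1ddX j l) C1N Uu); congr (_ + _).
by rewrite (dot_partialN _ _ Uu) dd_coordsE -!row_mul mxE.
Qed.

(** Flatness of the ambient space enters as the commutation of the third partials of [X]. *)
Lemma codazzi u i j l : U u ->
  let G := invmx (metric X u) in
  let h := second_form X N u in
  let A := dd_coords u in
  let D := d_second_form u in
  (D i - h *m G *m (A i)^T - A i *m G *m h) j l =
  (D l - h *m G *m (A l)^T - A l *m G *m h) j i.
Proof.
move=> Uu; apply: (@covariant_symmetry _ _ _ _ _ _ (fun a b c =>
  dot (partial a (partial b (partial c X)) u) (N u))).
- exact: invmx_metric_sym.
- exact: second_form_sym.
- by move=> a b c; exact: dd_coords_swap.
- by move=> a b c; exact: d_second_formE.
- by move=> a b c; rewrite (partial_third_swap a b c Uu).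
Qed.

End AtPoint.

End LocalHypersurface.

(** * The elliptic equation for the mean curvature of a self-expander *)

Section ExpanderIdentity.
Variables (R : realType) (n : nat).
Variables (U : set 'rV[R]_n) (X N : 'rV[R]_n -> 'rV[R]_n.+1).
Hypothesis HXN : local_hypersurface U X N.

Let nearU u : U u -> \forall v \near u, U v.
Proof. by move=> Uu; apply: open_nbhs_nbhs; split=> //; exact: lh_open HXN. Qed.

Let C1X : Ck 1 U X. Proof. exact: CkW (CkW (lh_X HXN)). Qed.
Let C1N : Ck 1 U N. Proof. exact: CkW (lh_N HXN). Qed.
Let C1dX i : Ck 1 U (partial i X).
Proof. exact: Ck_partial (CkW (lh_X HXN)). Qed.
Let C1dN i : Ck 1 U (partial i N). Proof. exact: Ck_partial (lh_N HXN). Qed.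
Let C1ddX i j : Ck 1 U (partial i (partial j X)).
Proof. exact: Ck_partial (Ck_partial j (lh_X HXN)). Qed.

Lemma derivable_dot m (Y Z : 'rV[R]_n -> 'rV[R]_m) u v :
  Ck 1 U Y -> Ck 1 U Z -> U u -> derivable (fun x => dot (Y x) (Z x)) u v.
Proof.
move=> CY CZ Uu; exact: (@ex_derive _ _ _ _ _ _ _ (is_derive_dot
  (Ck_derivable (v := v) CY Uu) (Ck_derivable (v := v) CZ Uu))).
Qed.

Lemma partial_scale (f : 'rV[R]_n -> R) (a : R) i u :
  derivable f u (delta_mx 0 i) ->
  partial i (fun v => a * f v) u = a * partial i f u.
Proof.
move=> /derivableP df.
have := is_derive_mul (is_derive_cst a u (delta_mx 0 i)) df.
by rewrite mul0r add0r => -[].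
Qed.

Lemma derivable_metric u v : U u -> derivable (metric X) u v.
Proof.
move=> Uu; apply/derivable_mxP => i j; under eq_fun do rewrite mxE.
exact: derivable_dot (C1dX i) (C1dX j) Uu.
Qed.

Lemma derivable_second_form u v i j :
  U u -> derivable (fun x => second_form X N x i j) u v.
Proof.
move=> Uu; under eq_fun do rewrite mxE.
exact: derivable_dot (C1ddX i j) C1N Uu.
Qed.

(** The derivative of an inverse, with the derivative of the metric written by symbols of the first
    kind. *)
Lemma partial_invmx_metric u l : U u ->
  partial l (fun v => invmx (metric X v)) u =
  - (invmx (metric X u) *m (dd_coords X u l + (dd_coords X u l)^T)
     *m invmx (metric X u)).
Proof.
move=> Uu; rewrite /partial derive_invmx; last 2 first.
- exact: derivable_metric.
- by apply: filterS (nearU Uu) => v; exact: metric_unit HXN _.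
rewrite derive_mx; last exact: derivable_metric.
congr (- (_ *m _ *m _)); apply: (matrixP _ _).1 => i j.
rewrite [LHS]mxE [RHS]mxE [X in _ = _ + X]mxE.
exact: (partial_metric HXN l i j Uu).
Qed.

Lemma partial_mean_curvature u l : U u ->
  let G := invmx (metric X u) in
  partial l (local_mean_curvature X N) u =
  \tr (G *m d_second_form X N u l) -
  \tr (G *m (dd_coords X u l + (dd_coords X u l)^T) *m G *m second_form X N u).
Proof.
move=> Uu G.
have Ginv : derivable (fun x => invmx (metric X x)) u (delta_mx 0 l).
  apply: derivable_invmx; first exact: derivable_metric.
  by apply: filterS (nearU Uu) => v; exact: metric_unit HXN _.
have Hd : is_derive u (delta_mx 0 l) (local_mean_curvature X N)
    (\sum_i \sum_j (partial l (fun v => invmx (metric X v)) u i j *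
       second_form X N u i j + G i j * d_second_form X N u l i j)).
  apply: is_derive_big_sum => i _; apply: is_derive_big_sum => j _.
  apply: is_derive_mul.
    rewrite /partial derive_mx// mxE; apply: derivableP.
    by move: Ginv => /derivable_mxP; exact.
  rewrite /d_second_form mxE; apply: derivableP.
  exact: derivable_second_form.
rewrite /partial (@derive_val _ _ _ _ _ _ _ Hd) (partial_invmx_metric l Uu) -/G.
have hs := second_form_sym HXN Uu.
have Ds : (d_second_form X N u l)^T = d_second_form X N u l.
  apply: (matrixP _ _).1 => i j; rewrite [LHS]mxE [LHS]mxE [RHS]mxE.
  apply: near_eq_partial; apply: filterS (nearU Uu) => v Uv.
  by rewrite -[in LHS](second_form_sym HXN Uv) mxE.
move: (dd_coords X u l) (d_second_form X N u l) (second_form X N u) hs Ds.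
move=> A D h hs Ds.
under eq_bigr do rewrite big_split.
by rewrite big_split /= !sum_mul_mxtrace// mulNmx raddfN /= addrC.
Qed.

(** On an expander this is the mean curvature, in a form whose second partials require only two
    derivatives of [X] and [N]. *)
Let phi v := 2^-1 * dot (X v) (N v).

Lemma partial_support v j : U v ->
  partial j phi v = 2^-1 * dot (X v) (partial j N v).
Proof.
move=> Uv; rewrite partial_scale; last exact: derivable_dot C1X C1N Uv.
by rewrite (partial_dot j C1X C1N Uv) (lh_perp HXN Uv) add0r.
Qed.

Lemma partial2_support u i j : U u ->
  partial i (partial j phi) u = 2^-1 *
    (dot (partial i X u) (partial j N u) +
     dot (X u) (partial i (partial j N) u)).
Proof.
move=> Uu.
rewrite (@near_eq_partial _ _ _ _ (fun v => 2^-1 * dot (X v) (partial j N v))).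
  rewrite partial_scale; last exact: derivable_dot C1X (C1dN j) Uu.
  by rewrite (partial_dot i C1X (C1dN j) Uu).
by apply: filterS (nearU Uu) => v; exact: partial_support.
Qed.

(** Differentiate the equation [<d_j N, d_l X> = - h_jl] in direction [i]; the Weingarten equation
    evaluates the term with [d_i d_l X]. *)
Lemma ddN_coords u i j : U u ->
  partial i (partial j N) u *m (frame X u)^T =
  - row j (d_second_form X N u i - second_form X N u *m
      invmx (metric X u) *m (dd_coords X u i)^T).
Proof.
move=> Uu; apply: (rowP _ _).1 => l; rewrite coordsE.
have E : d_second_form X N u i j l =
    - (dot (partial i (partial j N) u) (partial l X u) +
       dot (partial j N u) (partial i (partial l X) u)).
  rewrite -(partial_dot i (C1dN j) (C1dX l) Uu) -mulN1r -partial_scale.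
    rewrite mxE; apply: near_eq_partial; apply: filterS (nearU Uu) => v Uv.
    by rewrite mulN1r (dot_partialN_partialX HXN j l Uv) opprK.
  exact: derivable_dot (C1dN j) (C1dX l) Uu.
have F : dot (partial j N u) (partial i (partial l X) u) =
    - (second_form X N u *m invmx (metric X u) *m (dd_coords X u i)^T) j l.
  rewrite dotC (dot_partialN HXN j _ Uu) (dd_coordsE X u i l); congr (- _).
  have Gs := invmx_metric_sym X u; have hs := second_form_sym HXN Uu.
  move: (dd_coords X u i) (invmx _) (second_form X N u) Gs hs => A G h Gs hs.
  have -> : h *m G *m A^T = (A *m G *m h)^T by rewrite !trmx_mul Gs hs mulmxA.
  by rewrite -!row_mul [LHS]mxE [RHS]mxE.
rewrite F in E.
move: (d_second_form X N u i) (_ *m (dd_coords X u i)^T) E => D K E.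
by rewrite !mxE E; ring.
Qed.

Hypothesis expander : forall v, U v -> local_mean_curvature X N v = phi v.

Lemma local_expander_identity u : U u ->
  local_laplacian X phi u + 2^-1 * dot (X u) (local_gradient X phi u)
  + local_norm2A X N u * phi u = - 2^-1 * phi u.
Proof.
move=> Uu.
pose G := invmx (metric X u); pose h := second_form X N u.
pose x := X u *m (frame X u)^T.
pose dphi : 'rV[R]_n := \row_j partial j phi u.
pose ddphi : 'M[R]_n := \matrix_(i, j) partial i (partial j phi) u.
have Gs : G^T = G by exact: invmx_metric_sym.
have hs : h^T = h := second_form_sym HXN Uu.
have dphiE k : dphi 0 k = partial k phi u by rewrite mxE.
have ddphiE i j : ddphi i j = partial i (partial j phi) u by rewrite mxE.
have := @expander_algebra R n G h (dd_coords X u) (d_second_form X N u)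
  x dphi ddphi (dot (X u) (N u)) Gs hs _ _ _ _ _.
have -> : \sum_i \sum_j G i j * (ddphi i j - \sum_k
    (\sum_l G k l * dd_coords X u i j l) * dphi 0 k) = local_laplacian X phi u.
  apply: eq_bigr => i _; apply: eq_bigr => j _; rewrite ddphiE.
  congr (_ * (_ - _)); apply: eq_bigr => k _.
  by rewrite dphiE (christoffelE HXN k i j Uu).
have -> : \sum_i \sum_j G i j * dphi 0 j * x 0 i =
    dot (X u) (local_gradient X phi u).
  rewrite dot_sumr; apply: eq_bigr => i _; rewrite dot_sumr.
  by apply: eq_bigr => j _; rewrite dotZr dphiE /x coordsE.
have -> : \tr (G *m h *m G *m h) = local_norm2A X N u.
  by rewrite -sum4_mxtrace.
apply.
- by move=> i j l; exact: (codazzi HXN i j l Uu).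
- apply: (rowP _ _).1 => j; rewrite dphiE (partial_support j Uu).
  rewrite (dot_partialN HXN j _ Uu) [RHS]mxE -/G -/h -/x.
  by move: ((x *m G *m h) 0 j) => a; ring.
(* The product of [X] with the second derivative of [N] is split into its normal and tangential
   parts. *)
- move=> i j; rewrite ddphiE (partial2_support i j Uu) (dotC (partial i X u)).
  rewrite (dot_partialN_partialX HXN j i Uu) -/h.
  rewrite (dot_frameE HXN _ _ Uu) -/x (dot_ddN_N HXN i j Uu).
  rewrite (dot_partialN HXN j _ Uu) (weingarten HXN i Uu) (ddN_coords i j Uu).
  rewrite -/G -/h.
  move: (dd_coords X u i) (d_second_form X N u i) => A D.
  have -> : (- row i h *m G *m h) 0 j = - (h *m G *m h) i j.
    by rewrite !mulNmx -!row_mul !mxE.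
  move: (D - _) => M.
  have -> : (x *m G *m (- row j M)^T) 0 0 = - (M *m G *m x^T) j 0.
    rewrite -[LHS]trace_mx11 -mxtrace_tr !trmx_mul trmxK Gs trace_mx11.
    by rewrite mulmxA !mulNmx -!row_mul !mxE.
  have -> : h j i = h i j by rewrite -[in LHS]hs mxE.
  move: ((_ *m x^T) j 0) (dot _ _) ((h *m G *m h) i j) (h i j) => a b c d.
  by ring.
- rewrite -sum_mul_mxtrace//; exact: expander Uu.
(* Here the expander equation is differentiated: it holds near [u]. *)
- move=> l; rewrite dphiE -(partial_mean_curvature l Uu).
  apply: near_eq_partial; apply: filterS (nearU Uu) => v Uv.
  by rewrite expander.
Qed.

End ExpanderIdentity.

(** * Chart independence of the mean curvature, and comparison at a maximum *)

Section LocalMaximum.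
Local Opaque partial.
Variables (R : realType) (n : nat).
Implicit Types (X N : 'rV[R]_n -> 'rV[R]_n.+1) (U : set 'rV[R]_n).

Lemma mean_curvature_mxtrace U X N u : local_hypersurface U X N -> U u ->
  local_mean_curvature X N u = \tr (invmx (metric X u) *m second_form X N u).
Proof.
by move=> H Uu; rewrite -sum_mul_mxtrace; last exact: (second_form_sym H Uu).
Qed.

Lemma norm2A_mxtrace U X N u : local_hypersurface U X N -> U u ->
  local_norm2A X N u = \tr (invmx (metric X u) *m second_form X N u *m
    invmx (metric X u) *m second_form X N u).
Proof.
move=> H Uu; rewrite -sum4_mxtrace; first by [].
- exact: invmx_metric_sym.
- exact: (second_form_sym H Uu).
Qed.

(** An explicit factorization of the inverse metric, from which the signs of [|A|^2] and of the
    traced Hessian follow. *)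
Lemma invmx_metric_gram U X N u : local_hypersurface U X N -> U u ->
  let B := invmx (metric X u) *m frame X u in
  invmx (metric X u) = B *m B^T.
Proof.
move=> H Uu B; rewrite /B trmx_mul invmx_metric_sym !mulmxA.
rewrite -(mulmxA (invmx _)) -metricE mulVmx ?mul1mx//.
exact: (metric_unit H Uu).
Qed.

Lemma norm2A_ge0 U X N u : local_hypersurface U X N -> U u ->
  0 <= local_norm2A X N u.
Proof.
move=> H Uu; rewrite (norm2A_mxtrace H Uu) (invmx_metric_gram H Uu).
exact: (mxtrace_sqr_ge0 _ (second_form_sym H Uu)).
Qed.

Lemma frame_comp m (Y1 : 'rV[R]_n -> 'rV[R]_m) (Y2 : 'rV[R]_n -> 'rV[R]_m)
    (phi : 'rV[R]_n -> 'rV[R]_n) u :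
  (\forall v \near u, Y1 v = Y2 (phi v)) ->
  differentiable phi u -> differentiable Y2 (phi u) ->
  \matrix_i partial i Y1 u =
  (\matrix_i partial i phi u) *m (\matrix_i partial i Y2 (phi u)).
Proof.
move=> E dphi dY; apply: (row_matrixP _ _).1 => i.
rewrite row_mul !rowK (near_eq_partial i E) (partial_comp i dphi dY).
rewrite mulmx_sum_row; apply: eq_bigr => a _.
by rewrite rowK.
Qed.

(** In this form [h] contains first derivatives only, so a change of coordinates acts on it through
    its Jacobian alone. *)
Lemma second_form_frames U X N u : local_hypersurface U X N -> U u ->
  second_form X N u = - ((\matrix_i partial i N u) *m (frame X u)^T).
Proof.
move=> H Uu; apply: (row_matrixP _ _).1 => i.
by rewrite linearN /= row_mul rowK (weingarten H i Uu) opprK.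
Qed.

Lemma mean_curvature_invariant U1 U2 X1 N1 X2 N2
    (phi : 'rV[R]_n -> 'rV[R]_n) u :
  local_hypersurface U1 X1 N1 -> local_hypersurface U2 X2 N2 ->
  U1 u -> U2 (phi u) -> differentiable phi u ->
  (\forall v \near u, X1 v = X2 (phi v)) ->
  (\forall v \near u, N1 v = N2 (phi v)) ->
  local_mean_curvature X1 N1 u = local_mean_curvature X2 N2 (phi u).
Proof.
move=> H1 H2 U1u U2u dphi EX EN.
rewrite (mean_curvature_mxtrace H1 U1u) (mean_curvature_mxtrace H2 U2u).
have dX2 := Ck_differentiable (lh_X H2) U2u.
have dN2 := Ck_differentiable (lh_N H2) U2u.
apply: (@change_of_frame_mxtrace _ _ (\matrix_i partial i phi u)).
- exact: (metric_unit H1 U1u).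
- by rewrite !metricE /frame (frame_comp EX dphi dX2) trmx_mul !mulmxA.
rewrite (second_form_frames H1 U1u) (second_form_frames H2 U2u) /frame.
rewrite (frame_comp EX dphi dX2) (frame_comp EN dphi dN2).
by rewrite mulmxN mulNmx trmx_mul !mulmxA.
Qed.

(** At the maximum of [s f - t phi] the first partials vanish, so gradient and Christoffel terms
    agree on both sides; what remains is the coordinate Hessian traced with the positive inverse
    metric. *)
Lemma local_maximum_inequality U X N (f : 'rV[R]_n -> R) (s t : R) u :
  local_hypersurface U X N -> Ck 2 U f -> U u ->
  let phi v := 2^-1 * dot (X v) (N v) in
  (forall v, U v -> s * f v - t * phi v <= s * f u - t * phi u) ->
  s * (local_laplacian X f u + 2^-1 * dot (X u) (local_gradient X f u)) <=
  t * (local_laplacian X phi u + 2^-1 * dot (X u) (local_gradient X phi u)).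
Proof.
move=> H Cf Uu phi wmax.
have C1X : Ck 1 U X := CkW (CkW (lh_X H)).
have C1N : Ck 1 U N := CkW (lh_N H).
have C1dN j : Ck 1 U (partial j N) := Ck_partial j (lh_N H).
have oU := lh_open H.
have nU : \forall x \near u, U x by apply: open_nbhs_nbhs.
pose g j v := s * partial j f v - t * (2^-1 * dot (X v) (partial j N v)).
have dphi v : U v -> differentiable phi v.
  move=> Uv; apply: differentiableM; first exact: differentiable_cst.
  exact: differentiable_dot (Ck_differentiable C1X Uv)
    (Ck_differentiable C1N Uv).
have dphi' j : differentiable (fun v => 2^-1 * dot (X v) (partial j N v)) u.
  apply: differentiableM; first exact: differentiable_cst.
  exact: differentiable_dot (Ck_differentiable C1X Uu)
    (Ck_differentiable (C1dN j) Uu).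
have dE (a b : 'rV[R]_n -> R) v : differentiable a v -> differentiable b v ->
    differentiable (fun x => s * a x - t * b x) v.
  move=> da db; apply: differentiableB; apply: differentiableM => //;
    exact: differentiable_cst.
have pE i (a b : 'rV[R]_n -> R) v : differentiable a v -> differentiable b v ->
    partial i (fun x => s * a x - t * b x) v =
    s * partial i a v - t * partial i b v.
  move=> /(diff_derivable (v := delta_mx 0 i)) da.
  move=> /(diff_derivable (v := delta_mx 0 i)) db.
  have /derivableP dsa := derivable_mul (derivable_cst s v _) da.
  have /derivableP dtb := derivable_mul (derivable_cst t v _) db.
  rewrite -(partial_scale s da) -(partial_scale t db).
  exact: (@derive_val _ _ _ _ _ _ _ (is_deriveB dsa dtb)).
have [|||dw0 ddw] := @derivative_test_at_max R n U
    (fun v => s * f v - t * phi v) g u oU Uu _ _ _ wmax.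
- move=> v Uv; apply: dE; last exact: dphi.
  exact: Ck_differentiable Cf Uv.
- move=> v j Uv; rewrite pE; [|exact: Ck_differentiable Cf Uv|exact: dphi].
  by rewrite (partial_support H j Uv).
- move=> j; apply: dE; last exact: dphi'.
  exact: Ck_differentiable (Ck_partial j Cf) Uu.
have df i : s * partial i f u = t * partial i phi u.
  have := dw0 i; rewrite pE; [|exact: Ck_differentiable Cf Uu|exact: dphi].
  by move/eqP; rewrite subr_eq0 => /eqP.
have dg i j : partial i (g j) u =
    s * partial i (partial j f) u - t * partial i (partial j phi) u.
  rewrite pE; [|exact: Ck_differentiable (Ck_partial j Cf) Uu|exact: dphi'].
  congr (_ - _ * _); apply: near_eq_partial.
  by apply: filterS nU => v Uv; rewrite (partial_support H j Uv).
have grad : s * dot (X u) (local_gradient X f u) =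
    t * dot (X u) (local_gradient X phi u).
  rewrite !dot_sumr !mulr_sumr; apply: eq_bigr => i _.
  rewrite !dot_sumr !mulr_sumr; apply: eq_bigr => j _.
  by rewrite !dotZr -!mulrA !(mulrCA _ (invmx _ _ _)) !(mulrA s) !(mulrA t) df.
rewrite !mulrDr !(mulrCA _ 2^-1) grad lerD2r -subr_le0.
have -> : s * local_laplacian X f u - t * local_laplacian X phi u =
    \sum_i \sum_j invmx (metric X u) i j * partial i (g j) u.
  rewrite !mulr_sumr -sumrB; apply: eq_bigr => i _.
  rewrite !mulr_sumr -sumrB; apply: eq_bigr => j _.
  have : s * \sum_k christoffel X u k i j * partial k f u =
      t * \sum_k christoffel X u k i j * partial k phi u.
    by rewrite !mulr_sumr; apply: eq_bigr => k _; rewrite mulrCA df mulrCA.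
  rewrite dg; move: (\sum_k _) (\sum_k _) => a b.
  move: (partial i (partial j f) u) => c ab.
  move: (partial i (partial j phi) u) (invmx _ _ _) => d G.
  by rewrite !(mulrCA _ G) -mulrBr !mulrBr ab; ring.
rewrite (invmx_metric_gram H Uu).
exact: trace_product_le0.
Qed.

End LocalMaximum.

(** * The maximum principle *)

Lemma continuous_dot (R : realType) (T : topologicalType) m
    (Y Z : T -> 'rV[R]_m) :
  continuous Y -> continuous Z -> continuous (fun p => dot (Y p) (Z p)).
Proof.
have coord (W : T -> 'rV[R]_m) i :
    continuous W -> continuous (fun p => W p 0 i).
  move=> cW p; exact: (@continuous_comp _ _ _ W (fun M : 'rV[R]_m => M 0 i) p
    (cW p) (@coord_continuous _ _ _ _ _ _)).
move=> cY cZ p; apply: cvg_big => [|i _]; first exact: add_continuous.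
by apply: cvgM; exact: coord.
Qed.

Lemma vanishes_at_infinityP (R : realType) (n : nat) (S : smooth_manifold R n)
    (F : S -> 'rV[R]_n.+1) (q : S -> R) (e : R) :
  vanishes_at_infinity F q -> 0 < e ->
  exists r, forall p, r <= enorm (F p) -> q p < e.
Proof.
move=> qv e0.
have : nbhs 0%E [set y : \bar R | (y < e%:E)%E].
  by apply: (@nbhs_open_ereal_lt _ 0 (fun=> e)).
(* The limit controls radii strictly above [M], hence the radius [M + 1]. *)
move=> /qv [M [_ HM]]; exists (M + 1) => p pM.
have /= := HM (M + 1); rewrite ltrDl ltr01 => /(_ isT) sup_lt.
rewrite -lte_fin; apply: le_lt_trans sup_lt.
apply: ereal_sup_ubound; right; exists p => //=.
by apply/negP; rewrite -leNgt.
Qed.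

(** * From charts to the manifold, and comparison of the eigenfunction with [H] *)

Section MaximumPrinciple.
Variables (R : realType) (n : nat) (S : smooth_manifold R n).
Variables (F nu : S -> 'rV[R]_n.+1).
Implicit Type f : S -> R.

Lemma chart_at_atlas (p : S) : atlas (chart_at p).
Proof. by rewrite /chart_at; case: cid2. Qed.

Lemma chart_at_cdom (p : S) : cdom (chart_at p) p.
Proof. by rewrite /chart_at; case: cid2. Qed.

Lemma chart_imageK (c : chart R n S) u :
  (cmap c @` cdom c) u -> cdom c (cinv c u) /\ cmap c (cinv c u) = u.
Proof. by move=> [p cp <-]; rewrite cmapK. Qed.

Lemma near_cdom (c d : chart R n S) u :
  (cmap c @` cdom c) u -> cdom d (cinv c u) ->
  \forall v \near u, (cmap c @` cdom c) v /\ cdom d (cinv c v).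
Proof.
move=> cu du; apply: filterI.
  by apply: open_nbhs_nbhs; split=> //; exact: cimg_open.
apply: (cinv_continuous cu); apply: open_nbhs_nbhs; split=> //.
exact: cdom_open.
Qed.

Lemma CkM_continuous (W : normedModType R) k (f : S -> W) :
  CkM k f -> continuous f.
Proof.
move=> Cf p; set c := chart_at p.
have cp : cdom c p := chart_at_cdom p.
have ncp : \forall q \near p, cdom c q.
  by apply: open_nbhs_nbhs; split=> //; exact: cdom_open.
have : {for p, continuous ((f \o cinv c) \o cmap c)}.
  apply: continuous_comp; first exact: cmap_continuous.
  apply: Ck_continuous (Cf c (chart_at_atlas p)) _.
  by exists p.
rewrite /prop_for /continuous_at /= cmapK//.
apply: cvg_trans; apply: near_eq_cvg.
by apply: filterS ncp => q cq; rewrite /= cmapK.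
Qed.

Hypothesis F_immersion : smooth_immersion F.
Hypothesis nu_normal : unit_normal F nu.

Lemma local_hypersurface_chart c : atlas c ->
  local_hypersurface (cmap c @` cdom c) (F \o cinv c) (nu \o cinv c).
Proof.
move=> ac; have [CF F_free] := F_immersion; have [Cnu nu1 nuF] := nu_normal.
split.
- exact: cimg_open.
- exact: CF.
- exact: Cnu.
- exact: F_free.
- move=> u [p cp <-] i; rewrite /= (cmapK cp).
  exact: nuF.
- move=> u _ /=; have := nu1 (cinv c u); rewrite /enorm.
  move=> /(congr1 (fun x => x ^+ 2)).
  by rewrite sqr_sqrtr ?expr1n// dot_ge0.
Qed.

(** The chart selected by [mean_curvature] varies with the point; this computes [H] in one fixed
    chart throughout its domain, where it can be differentiated. *)
Lemma mean_curvature_chart c u : atlas c -> (cmap c @` cdom c) u ->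
  local_mean_curvature (F \o cinv c) (nu \o cinv c) u =
  mean_curvature F nu (cinv c u).
Proof.
move=> ac cu; rewrite /mean_curvature; set d := chart_at _.
have ad : atlas d := chart_at_atlas _.
have dp : cdom d (cinv c u) := chart_at_cdom _.
have near_d := near_cdom cu dp.
have [cp cpu] := chart_imageK cu.
apply: (@mean_curvature_invariant _ _ _ _ _ _ _ _ (cmap d \o cinv c)
  u (local_hypersurface_chart ac) (local_hypersurface_chart ad)) => //.
- by exists (cinv c u).
- apply: Ck_differentiable (atlas_compatible ac ad 1) _.
  by exists (cinv c u).
- by apply: filterS near_d => v [_ dv] /=; rewrite cmapK.
- by apply: filterS near_d => v [_ dv] /=; rewrite cmapK.
Qed.

Hypothesis F_expander : self_expander F nu.

Lemma mean_curvature_continuous : continuous (mean_curvature F nu).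
Proof.
have [CF _] := F_immersion; have [Cnu _ _] := nu_normal.
have cF := CkM_continuous (CF 0%N); have cnu := CkM_continuous (Cnu 0%N).
have -> : mean_curvature F nu = (fun p => 2^-1 * dot (F p) (nu p)).
  by apply/funext => p; rewrite F_expander.
by move=> p; apply: cvgM; [exact: cvg_cst|exact: continuous_dot].
Qed.

(* [(L + 1/2) (s f - t H) <= |A|^2 (s f - t H)] at a maximum, while
   [(L + 1/2) H = - H / 2]. *)
Lemma eigenfunction_at_maximum (lambda s t : R) f p : CkM 2 f ->
  (forall q, stability_operator F nu f q + 2^-1 * f q = lambda * f q) ->
  (forall q, s * f q - t * mean_curvature F nu q <=
             s * f p - t * mean_curvature F nu p) ->
  lambda * (s * f p) + t * (2^-1 * mean_curvature F nu p) <=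
  normA F nu p ^+ 2 * (s * f p - t * mean_curvature F nu p).
Proof.
move=> Cf f_eigen fmax; have := f_eigen p.
rewrite /stability_operator /laplacian /gradient /normA.
set c := chart_at p; set u := cmap c p.
have ac : atlas c := chart_at_atlas p; have cp : cdom c p := chart_at_cdom p.
have cu : (cmap c @` cdom c) u by exists p.
have LH := local_hypersurface_chart ac.
rewrite sqr_sqrtr; last exact: (norm2A_ge0 LH cu).
have expl v : (cmap c @` cdom c) v ->
    local_mean_curvature (F \o cinv c) (nu \o cinv c) v =
    2^-1 * dot ((F \o cinv c) v) ((nu \o cinv c) v).
  by move=> cv; rewrite mean_curvature_chart// F_expander.
have := local_expander_identity LH expl cu.
have := local_maximum_inequality (s := s) (t := t) LH (Cf c ac) cu.
rewrite /= (_ : cinv c u = p); last exact: cmapK.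
move=> HM; have prem : forall v : 'rV[R]_n,
    (exists2 x : S, cdom c x & cmap c x = v) ->
    s * f (cinv c v) - t * (2^-1 * dot (F (cinv c v)) (nu (cinv c v))) <=
    s * f p - t * (2^-1 * dot (F p) (nu p)).
  by move=> v _; rewrite -!F_expander; exact: fmax.
move: (HM prem); rewrite F_expander.
move: (local_laplacian _ _ _ + _) (local_laplacian _ _ _ + _) => b a.
move: (local_norm2A _ _ _) (2^-1 * dot _ _) (f p) => A m y ab bE yE.
(* [a] and [b] are the second and first order terms of the operator at [f] and at [H]; in [yE] the
   two halves of [y] cancel. *)
have {bE} bE : b = - 2^-1 * m - A * m by rewrite -bE addrK.
have -> : lambda * (s * y) = s * a + A * (s * y) by rewrite mulrCA -yE; ring.
by rewrite bE in ab; move: ab; rewrite !(mulrDr, mulrN); lra.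
Qed.

Hypothesis F_complete : complete_immersion F.
Hypothesis F_mean_convex : mean_convex F nu.
Hypothesis A_vanishes : vanishes_at_infinity F (normA F nu).

Let H := mean_curvature F nu.

Lemma le_mean_curvature_extends (lambda s t r : R) f : 0 <= t -> 0 < lambda ->
  CkM 2 f ->
  (forall q, stability_operator F nu f q + 2^-1 * f q = lambda * f q) ->
  vanishes_at_infinity F (fun p => `|s * f p|) ->
  (forall p, r <= enorm (F p) -> normA F nu p ^+ 2 <= lambda / 2) ->
  (forall p, enorm (F p) <= r -> s * f p <= t * H p) ->
  forall p, s * f p <= t * H p.
Proof.
move=> t0 lam0 Cf f_eigen f_vanishes A_small fK q.
rewrite leNgt -subr_gt0; apply/negP => wq0; set w := fun p => s * f p - t * H p.
have [r2 Hr2] := vanishes_at_infinityP f_vanishes wq0.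
(* This ball contains [q], and outside it [s * f], hence [w], is below [w q]; the maximum of [w] on
   [K] is therefore global. *)
pose K := [set p | enorm (F p) <= Num.max r2 (enorm (F q))].
have Kq : K q by rewrite /K /= le_max lexx orbT.
have cw : continuous w.
  move=> p; apply: cvgB; apply: cvgM; [exact: cvg_cst| |exact: cvg_cst|].
    exact: (CkM_continuous Cf).
  exact: mean_curvature_continuous.
have cK : compact K by exact: F_complete.
have [p /set_mem Kp pmaxK] := compact_EVT_max (ex_intro _ q Kq) cK
  (continuous_subspaceT cw).
have wqp : w q <= w p by apply: pmaxK; exact/mem_set.
have tH p' : 0 <= t * H p' by rewrite mulr_ge0// ltW// F_mean_convex.
have pmax x : w x <= w p.
  have [xK|xK] := leP (enorm (F x)) (Num.max r2 (enorm (F q))).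
    by apply: pmaxK; exact/mem_set.
  apply: le_trans wqp; apply: ltW; apply: le_lt_trans (Hr2 x _).
    by apply: le_trans (ler_norm _); rewrite gerBl.
  by move: xK; rewrite gt_max => /andP[/ltW].
have wp0 : 0 < w p := lt_le_trans wq0 wqp.
have rp : r < enorm (F p).
  rewrite ltNge; apply/negP => /fK.
  by rewrite leNgt -subr_gt0 wp0.
have := eigenfunction_at_maximum Cf f_eigen pmax.
have := A_small p (ltW rp); have := tH p.
have := F_mean_convex p; move: wp0; rewrite /w -/H.
move: (normA F nu p ^+ 2) (s * f p) (H p) => A y m.
move=> wp0 m0 tm0 Asm; apply/negP; rewrite -ltNge.
(* The other side is at least [lambda * y], and [lambda * y >= lambda * (y - t * m)], which is
   strictly above this bound. *)
have : A * (y - t * m) <= lambda / 2 * (y - t * m) by rewrite ler_wpM2r// ltW.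
have : 0 < lambda * (y - t * m) by rewrite mulr_gt0.
have : 0 <= lambda * (t * m) by rewrite mulr_ge0// ltW.
by rewrite !mulrBr; lra.
Qed.

Lemma eigenfunction_le0 (lambda s : R) f : 0 < lambda -> CkM 2 f ->
  (forall q, stability_operator F nu f q + 2^-1 * f q = lambda * f q) ->
  vanishes_at_infinity F (fun p => `|s * f p|) ->
  forall p, s * f p <= 0.
Proof.
move=> lam0 Cf f_eigen f_vanishes q.
have lam20 : 0 < lambda / 2 by rewrite divr_gt0.
have [r Hr] : exists r, forall p, r <= enorm (F p) ->
    normA F nu p < Num.sqrt (lambda / 2).
  by apply: vanishes_at_infinityP => //; rewrite sqrtr_gt0.
have A_small p : r <= enorm (F p) -> normA F nu p ^+ 2 <= lambda / 2.
  move=> /Hr/ltW Ale; rewrite -[leRHS](sqr_sqrtr (ltW lam20)).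
  by apply: lerXn2r => //; exact: sqrtr_ge0.
have ext t (t0 : 0 <= t) :=
  le_mean_curvature_extends t0 lam0 Cf f_eigen f_vanishes A_small.
rewrite leNgt; apply/negP => fq0.
(* Otherwise the extension with [t = 0] would give [s * f <= 0] everywhere. *)
have [q' [Kq' fq']] : exists q', enorm (F q') <= r /\ 0 < s * f q'.
  apply/not_existsP => noq; move: fq0; apply/negP; rewrite -leNgt.
  rewrite -(mul0r (H q)); apply: (ext 0 (lexx 0)) => p Kp; rewrite mul0r leNgt.
  by apply/negP => fp; apply: (noq p).
have H0 p : H p != 0 by rewrite gt_eqF// F_mean_convex.
have cw : continuous (fun p => s * f p / H p).
  move=> p; apply: cvgM.
    by apply: cvgM; [exact: cvg_cst|exact: (CkM_continuous Cf)].
  by apply: cvgV => //; exact: mean_curvature_continuous.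
have cK : compact [set p | enorm (F p) <= r] by exact: F_complete.
have [p /set_mem Kp pmaxK] := compact_EVT_max (ex_intro _ q' Kq') cK
  (continuous_subspaceT cw).
(* The least [t] with [s * f <= t * H] on the ball, attained at [p]. *)
set t := s * f p / H p in pmaxK.
have t0 : 0 < t.
  apply: lt_le_trans (pmaxK q' (mem_set Kq')).
  by rewrite divr_gt0// F_mean_convex.
have ft x : s * f x <= t * H x.
  apply: (ext t (ltW t0)) => {}x Kx.
  rewrite -ler_pdivrMr; last exact: F_mean_convex.
  by apply: pmaxK; exact: mem_set.
have fp : s * f p = t * H p by rewrite /t divfK.
have pmax x : s * f x - t * H x <= s * f p - t * H p.
  by rewrite fp subrr subr_le0.
(* At the contact point the right-hand side vanishes, while both terms on the left are positive. *)
have := eigenfunction_at_maximum Cf f_eigen pmax; rewrite -/H fp subrr mulr0.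
have Hp : 0 < H p := F_mean_convex p.
apply/negP; rewrite -ltNge; apply: addr_gt0.
  exact: mulr_gt0 lam0 (mulr_gt0 t0 Hp).
by apply: mulr_gt0 t0 (mulr_gt0 _ Hp); rewrite invr_gt0.
Qed.

End MaximumPrinciple.

Theorem theorem2p6 (R : realType) (n : nat) (S : smooth_manifold R n)
    (F nu : S -> 'rV[R]_n.+1)
    (F_immersion : smooth_immersion F)
    (nu_normal : unit_normal F nu)
    (F_complete : complete_immersion F)
    (F_expander : self_expander F nu)
    (F_mean_convex : mean_convex F nu)
    (A_vanishes : vanishes_at_infinity F (normA F nu))
    (lambda : R) (lambda_gt0 : 0 < lambda)
    (f : S -> R) (f_C2 : CkM 2 f)
    (f_eigen : forall p,
       stability_operator F nu f p + 2^-1 * f p = lambda * f p)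
    (f_vanishes : vanishes_at_infinity F (fun p => `|f p|)) :
  forall p, f p = 0.
Proof.
(* The signs [s = 1] and [s = -1] give the two inequalities. *)
have eigen_le0 s : `|s| = 1 -> forall p, s * f p <= 0.
  move=> s1; apply: (eigenfunction_le0 F_immersion nu_normal F_expander
    F_complete F_mean_convex A_vanishes lambda_gt0 f_C2 f_eigen).
  by under eq_fun do rewrite normrM s1 mul1r.
move=> p; apply/eqP; rewrite eq_le.
have := eigen_le0 1 (normr1 _) p; have := eigen_le0 (-1) (normrN1 _) p.
by rewrite mulN1r mul1r oppr_le0 => -> ->.
Qed.
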